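(* For every integer $n\ge 5$ the $(n+3)$-point quadrature formula $$Q_{n+3}[f]=\frac{43}{192n}\sigma(0)+\frac{29}{72n}\sigma\Big(\frac1{2n}\Big)+\frac{83}{96n}\sigma\Big(\frac1n\Big)+\frac{581}{576n}\sigma\Big(\frac2n\Big)+\frac1n\sum_{k=3}^{n-3}f\Big(\frac kn\Big),\qquad \sigma(x):=f(x)+f(1-x),$$ is negative definite of order $4$, with error constant $$c_4(Q_{n+3})=-\frac{7}{5760\,n^4}\Big(1+\frac{55}{28\,n}\Big),$$ and the sequence $\{Q_{n+3}\}$ is asymptotically optimal negative definite of order $4$, i.e. $\lim_{n\to\infty}c_4(Q_{n+3})/c^{-}_{n+3,4}=1$.
   Context: An $N$-point quadrature formula is a functional $Q[f]=\sum_{i=1}^{N}a_i f(\tau_i)$ with nodes $0\le\tau_1<\dots<\tau_N\le 1$ and real weights; its remainder is $R[Q;f]=\int_0^1 f(x)\,dx-Q[f]$. $Q$ is negative definite of order $4$, with error constant $c_4(Q)$, if there is a constant $c_4(Q)<0$ such that for every $f\in C^4[0,1]$ there is $\xi\in[0,1]$ with $R[Q;f]=c_4(Q)f^{(4)}(\xi)$. $c^{-}_{N,4}$ denotes the supremum (largest negative value) of $c_4(Q)$ over all $N$-point negative definite quadrature formulae $Q$ of order $4$. Empty sums are $0$. *)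

(* Defs.v *)
From Stdlib Require Import Reals.
From Coquelicot Require Import Coquelicot.
Open Scope R_scope.

(* Functions on [0,1] are represented by total functions R -> R; all notions
   below depend only on their values on [0,1]. *)
Definition I01 (x : R) : Prop := 0 <= x <= 1.

(* [nth_deriv_on01 r f g]: on [0,1], g is the r-th derivative of f.  Since
   [D_in] takes limits along [0,1] only, derivatives at the endpoints are
   one-sided. *)
Fixpoint nth_deriv_on01 (r : nat) (f g : R -> R) : Prop :=
  match r with
  | O => forall x, I01 x -> g x = f x
  | S r' => exists f1 : R -> R,
      (forall x, I01 x -> D_in f f1 I01 x) /\ nth_deriv_on01 r' f1 g
  end.

(* f belongs to C^r[0,1] and g is its r-th derivative on [0,1]. *)
Definition Cr01 (r : nat) (f g : R -> R) : Prop :=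
  nth_deriv_on01 r f g /\ (forall x, I01 x -> continue_in g I01 x).

Definition functional : Type := (R -> R) -> R.

(* Nodes and weights are indexed from 1 to N; the values of [a] and [tau] at
   other indices are irrelevant. *)
Definition is_quadrature (N : nat) (Q : functional) : Prop :=
  exists a tau : nat -> R,
    (forall i, (1 <= i <= N)%nat -> 0 <= tau i <= 1) /\
    (forall i j, (1 <= i)%nat -> (i < j)%nat -> (j <= N)%nat -> tau i < tau j) /\
    (forall f, Q f = sum_n_m (fun i => a i * f (tau i)) 1 N).

Definition remainder (Q : functional) (f : R -> R) : R := RInt f 0 1 - Q f.

(* Q is negative definite of order r with error constant c.  Testing on
   f(x) = x^r shows that c is determined by Q and r. *)
Definition negative_definite (r : nat) (Q : functional) (c : R) : Prop :=
  c < 0 /\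
  forall f fr : R -> R, Cr01 r f fr ->
    exists xi : R, I01 xi /\ remainder Q f = c * fr xi.

(* [real] sends an infinite supremum to 0.  Error constants are negative, so
   this only happens when no N-point negative definite formula exists. *)
Definition c_minus (N r : nat) : R :=
  real (Lub_Rbar (fun c => exists Q : functional,
                    is_quadrature N Q /\ negative_definite r Q c)).

(* Q n is a formula with N n points; finitely many n are disregarded. *)
Definition asymptotically_optimal_negative_definite
    (r : nat) (N : nat -> nat) (Q : nat -> functional) : Prop :=
  exists c : nat -> R,
    eventually (fun n => is_quadrature (N n) (Q n) /\
                         negative_definite r (Q n) (c n)) /\
    is_lim_seq (fun n => c n / c_minus (N n) r) 1.

Definition sigma (f : R -> R) (x : R) : R := f x + f (1 - x).

(* The formula with n + 3 nodes; for n = 5 the last sum runs from 3 to 2 and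
   [sum_n_m] gives 0. *)
Definition Qf (n : nat) : functional := fun f =>
  43 / (192 * INR n) * sigma f 0
  + 29 / (72 * INR n) * sigma f (1 / (2 * INR n))
  + 83 / (96 * INR n) * sigma f (1 / INR n)
  + 581 / (576 * INR n) * sigma f (2 / INR n)
  + 1 / INR n * sum_n_m (fun k => f (INR k / INR n)) 3 (n - 3).

(* Main.v *)
Require Import Defs.
From Stdlib Require Import Reals Lra Psatz Lia.
From Coquelicot Require Import Coquelicot.
Open Scope R_scope.

(** The error constant of a definite formula is the integral of its Peano
    kernel K, which is nonpositive, is C^2 with K = K' = K'' = 0 at 0 and 1, and
    is a quartic with K'''' = 1 between consecutive nodes.

    Upper bound on error constants: let e = N + 1 be the number of intervals cut
    out by the nodes, and rescale lengths by e.  A nonpositive quartic p with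
    p'''' = 1 on an interval of rescaled length h satisfies
      - int p >= 7/5760 (5 h - 4) + V(right end) - V(left end),
    where V is -(1/4) p' (p'' + 1/12) truncated at a fixed level.  Since p' and
    p'' are continuous across the nodes, the potentials telescope, and summation
    over the intervals gives -c >= 7/5760 / (N + 1)^4.  Equality holds for the
    monospline (B_4({x}) - 7/240) / 24, where h = 1 and p' = 0 at the knots.  This
    avoids comparison theorems for monosplines with free knots.

    Lower bound: for the given formula K is (B_4({n x}) - 7/240) / (24 n^4) on
    [2/n, 1 - 2/n] and an explicit quartic on the three remaining intervals at
    each end.  If f'''' >= 0, then K f''' - K' f'' + K'' f' - K''' f + int f is
    nonincreasing between nodes, whence the sign of the remainder. *)

(** * The potential inequality for one knot interval *)

(* In this section lengths are rescaled so that the optimal knot spacing is 1.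
   The quartic on a knot interval of length h is x = h y |-> h^4 P(y) with P
   centered at the midpoint; its value at the midpoint is h^4 q. *)
Definition centered_quartic (A k z q y : R) : R :=
  y ^ 4 / 24 + z * y ^ 3 / 6 + A * y ^ 2 / 2 + k * y + q.

Definition nonpos_quartic (A k z q : R) : Prop :=
  forall y, - (1 / 2) <= y <= 1 / 2 -> centered_quartic A k z q y <= 0.

(* The integral of -P over [-1/2, 1/2]. *)
Definition neg_integral (A q : R) : R := - (1 / 1920 + A / 24 + q).

(** By convexity h^5 lies above its tangent at c. Later proofs take numerical c near the critical
    length of the estimate at hand. *)
Lemma pow5_tangent (h c : R) : 0 <= h -> 0 <= c -> 5 * c ^ 4 * h - 4 * c ^ 5 <= h ^ 5.
Proof.
  intros Hh Hc.
  assert (E : h ^ 5 - (5 * c ^ 4 * h - 4 * c ^ 5)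
    = (h - c) ^ 2 * (h ^ 3 + 2 * c * h ^ 2 + 3 * c ^ 2 * h + 4 * c ^ 3)) by ring.
  assert (0 <= (h - c) ^ 2) by apply pow2_ge_0.
  assert (0 <= h ^ 3 + 2 * c * h ^ 2 + 3 * c ^ 2 * h + 4 * c ^ 3).
  { assert (0 <= h ^ 3) by (apply pow_le; lra).
    assert (0 <= c ^ 3) by (apply pow_le; lra).
    assert (0 <= c * h ^ 2) by (apply Rmult_le_pos; [lra | apply pow2_ge_0]).
    assert (0 <= c ^ 2 * h) by (apply Rmult_le_pos; [apply pow2_ge_0 | lra]).
    lra. }
  nra.
Qed.

Ltac at_point H y :=
  let K := fresh "P" in
  match type of H with nonpos_quartic ?A ?k ?z ?q =>
    assert (K : centered_quartic A k z q y <= 0) by (apply H; lra);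
    unfold centered_quartic in K; simpl in K
  end.

(** Reflection in the midpoint exchanges the ends of the interval, so estimates at the left end also
    serve the right end. *)
Lemma nonpos_quartic_flip A k z q : nonpos_quartic A k z q -> nonpos_quartic A (- k) (- z) q.
Proof.
  intros H y Hy. assert (K := H (- y) ltac:(lra)). unfold centered_quartic in *.
  replace (y ^ 4 / 24 + - z * y ^ 3 / 6 + A * y ^ 2 / 2 + - k * y + q)
    with ((- y) ^ 4 / 24 + z * (- y) ^ 3 / 6 + A * (- y) ^ 2 / 2 + k * - y + q) by field.
  exact K.
Qed.

(* Each linear lower bound for the integral of -P below comes from a quadrature
   formula with nonnegative weights at the sampled points. *)
Lemma neg_integral_simpson A k z q : nonpos_quartic A k z q -> 1 / 2880 <= neg_integral A q.
Proof.
  intros H. at_point H (1/2). at_point H (-(1/2)). at_point H 0. unfold neg_integral. lra.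
Qed.

Lemma neg_integral_ge_linear_coef A k z q :
  nonpos_quartic A k z q -> k / 6 - 1 / 11520 <= neg_integral A q.
Proof.
  intros H. at_point H (1/4). at_point H (-(1/2)). at_point H 0. unfold neg_integral. lra.
Qed.

(** These are P'(-1/2) and P''(-1/2). *)
Definition left_slope A k z := - (1 / 48) - A / 2 + k + z / 8.
Definition left_curvature A z := 1 / 8 + A - z / 2.

Lemma neg_integral_ge_left_slope A k z q :
  nonpos_quartic A k z q -> 6 / 10000 + 3 / 100 * left_slope A k z <= neg_integral A q.
Proof.
  intros H. at_point H (-(9/100)). at_point H (-(1/10)). at_point H 0.
  at_point H (1/2). at_point H (-(1/2)).
  unfold neg_integral, left_slope. lra.
Qed.

Lemma neg_integral_ge_left_curvature A k z q : nonpos_quartic A k z q ->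
  23 / 196 * left_slope A k z + 4 / 147 * left_curvature A z - 137 / 100000 <= neg_integral A q.
Proof.
  intros H. at_point H (1/10). at_point H (1/2). unfold neg_integral, left_slope, left_curvature. lra.
Qed.

Lemma left_curvature_ge A k z q : nonpos_quartic A k z q ->
  1 / 480 - left_slope A k z / 4 - left_curvature A z / 24 <= neg_integral A q.
Proof.
  intros H. at_point H 0. at_point H (1/2). at_point H (-(1/2)).
  unfold neg_integral, left_slope, left_curvature. lra.
Qed.

(* The cost of an interval of length h exceeds the tangent at h = 1 of the optimal
   cost 7/5760 h^5 by this much; the two potentials are -(1/4) p' (p'' + 1/12). *)
Definition excess A q h := h ^ 5 * neg_integral A q - 7 / 5760 * (5 * h - 4).
Definition end_potential A k z h :=
  - (1 / 4) * (h ^ 3 * (1 / 48 + A / 2 + k + z / 8)) * (h ^ 2 * (1 / 8 + A + z / 2) + 1 / 12).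
Definition start_potential A k z h :=
  - (1 / 4) * (h ^ 3 * left_slope A k z) * (h ^ 2 * left_curvature A z + 1 / 12).

(** The constant 7/2304 is twice the truncation level. This settles intervals whose potential is
    truncated from above at the left end and from below at the right end. *)
Lemma excess_simpson A k z q h : 0 < h -> nonpos_quartic A k z q -> - (7 / 2304) <= excess A q h.
Proof.
  intros Hh H. apply neg_integral_simpson in H. unfold excess.
  assert (T := pow5_tangent h (3/2) ltac:(lra) ltac:(lra)).
  assert (0 < h ^ 5) by (apply pow_lt; lra). nra.
Qed.

(** No truncated potential can increase by more than 7/2304, so intervals with a large slope k at
    the midpoint need no finer estimate. *)
Lemma excess_steep A k z q h :
  0 < h -> nonpos_quartic A k z q -> 1 / 2 <= k -> 7 / 2304 <= excess A q h.
Proof.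
  intros Hh H Hk. apply neg_integral_ge_linear_coef in H. unfold excess.
  assert (T := pow5_tangent h (35/100) ltac:(lra) ltac:(lra)).
  assert (0 < h ^ 5) by (apply pow_lt; lra).
  assert (h ^ 5 * (1/12 - 1/11520) <= h ^ 5 * neg_integral A q) by (apply Rmult_le_compat_l; lra).
  lra.
Qed.

(* Handles the intervals at whose right end the potential lies below the
   truncation level. *)
Lemma excess_start A k z q h : 0 < h -> nonpos_quartic A k z q -> excess A q h < 0 ->
  0 <= excess A q h + 7 / 4608 + start_potential A k z h.
Proof.
  intros Hh H HG.
  assert (S := neg_integral_simpson _ _ _ _ H). assert (C1 := neg_integral_ge_left_slope _ _ _ _ H).
  assert (C2 := neg_integral_ge_left_curvature _ _ _ _ H). assert (C3 := left_curvature_ge _ _ _ _ H).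
  unfold start_potential, excess in *.
  set (J := neg_integral A q) in *. set (t := left_slope A k z) in *. set (b := left_curvature A z) in *.
  clearbody J t b.
  assert (Hg : 0 < h ^ 5) by (apply pow_lt; lra).
  assert (Hh3 : 0 < h ^ 3) by (apply pow_lt; lra).
  assert (T1 := pow5_tangent h 1 ltac:(lra) ltac:(lra)).
  assert (T2 := pow5_tangent h (129/100) ltac:(lra) ltac:(lra)).
  assert (T3 := pow5_tangent h (130/100) ltac:(lra) ltac:(lra)).
  (* A negative excess forces 5 h > 4 and, by the tangent at 1, a value of J below the optimum
     7/5760. *)
  assert (HJ : J < 7 / 5760) by nra.
  assert (Hh8 : 8 / 10 < h) by nra.
  assert (E35 : h ^ 3 <= 25 / 16 * h ^ 5).
  { replace (h ^ 5) with (h ^ 3 * h ^ 2) by ring.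
    assert (16 / 25 <= h ^ 2) by nra. nra. }
  set (g := h ^ 5) in *.
  replace (- (1 / 4) * (h ^ 3 * t) * (h ^ 2 * b + 1 / 12))
    with (g * (- t * b / 4) + h ^ 3 * (- t / 48)) by (unfold g; field).
  (* The factor 438/10^6 is large enough for the final step: the tangents at 1.29 and 1.30 show that
     g * 438/10^6 is at least 7/5760 (5 h - 4) - 7/4608. *)
  assert (K : g * (438/1000000) <= g * J + (g * (- t * b / 4) + h ^ 3 * (- t / 48))).
  { destruct (Rle_or_lt 0 t) as [Ht|Ht].
    - assert (g * (25/16 * (- t / 48)) <= h ^ 3 * (- t / 48)) by nra.
      assert (438 / 1000000 <= J + - t * b / 4 + 25 / 16 * (- t / 48)).
      { assert (b <= 952/10000 - 431/100 * t) by lra.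
        assert (t * b <= t * (952/10000 - 431/100 * t)) by nra.
        (* With [C1] for J and the bound on b, a quadratic in t remains; the square is centred near
           its minimiser, and likewise for t < 0. *)
        assert (0 <= (t - 264/21550) ^ 2) by apply pow2_ge_0. nra. }
      nra.
    - assert (0 <= h ^ 3 * (- t / 48)) by nra.
      assert (438 / 1000000 <= J + - t * b / 4).
      { assert (1/48 - 6 * t <= b) by lra.
        assert (- t * (1/48 - 6 * t) <= - t * b) by nra.
        assert (0 <= (t + 248/30000) ^ 2) by apply pow2_ge_0. nra. }
      nra. }
  lra.
Qed.

Lemma excess_flat A k z q h : 0 < h -> nonpos_quartic A k z q -> - (1 / 2) <= k <= 1 / 2 ->
  end_potential A k z h - start_potential A k z h <= excess A q h.
Proof.
  intros Hh H Hk.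
  (* Sampling at y = k makes the bound on -q quadratic in k, which absorbs z k / 4. *)
  assert (P := H k ltac:(lra)). unfold centered_quartic in P.
  set (F := 9 * h ^ 5 + 10 * h ^ 3 - 75 * h + 56).
  set (B := - q + z * k / 4 + z ^ 2 / 32).
  (* All three terms on the right vanish for the optimal piece h = 1, A = -1/24, k = z = q = 0; F
     has a double zero at h = 1. *)
  assert (E : excess A q h - (end_potential A k z h - start_potential A k z h)
     = F / 11520 + h / 4 * (A * h ^ 2 + 1 / 24) ^ 2 + h ^ 5 * B).
  { unfold excess, end_potential, start_potential, left_slope, left_curvature, neg_integral, F, B. field. }
  assert (Hg : 0 < h ^ 5) by (apply pow_lt; lra).
  assert (HF : 0 <= F).
  { assert (T := pow5_tangent h 1 ltac:(lra) ltac:(lra)). unfold F.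
    assert (0 <= (h - 1) ^ 2 * (h + 2)) by (apply Rmult_le_pos; [apply pow2_ge_0 | lra]).
    nra. }
  assert (Hsq : 0 <= h / 4 * (A * h ^ 2 + 1 / 24) ^ 2)
    by (apply Rmult_le_pos; [lra | apply pow2_ge_0]).
  set (m := k ^ 2). assert (Hm : 0 <= m <= 1 / 4) by (unfold m; nra).
  (* [Eq] completes the square in z, and 3298/10000 is a lower bound for 1/2 - 5/8 m - 2/9 m^2 on 0
     <= m <= 1/4. *)
  assert (HB : m * (3298 / 10000 + A / 2) <= B).
  { assert (0 <= (z + 4 * k + 8 / 3 * k ^ 3) ^ 2) by apply pow2_ge_0.
    assert (Eq : B + (k ^ 4 / 24 + z * k ^ 3 / 6 + A * k ^ 2 / 2 + k * k + q)
      = (z + 4 * k + 8 / 3 * k ^ 3) ^ 2 / 32 + m * (1/2 + A / 2 - 5 / 8 * m - 2 / 9 * m ^ 2)).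
    { unfold B, m. field. }
    assert (m ^ 2 <= 1 / 16) by nra.
    assert (m * (3298 / 10000 + A / 2) <= m * (1/2 + A / 2 - 5 / 8 * m - 2 / 9 * m ^ 2)).
    { apply Rmult_le_compat_l; lra. }
    lra. }
  enough (0 <= F / 11520 + h / 4 * (A * h ^ 2 + 1 / 24) ^ 2 + h ^ 5 * B) by lra.
  destruct (Rle_or_lt 0 (3298 / 10000 + A / 2)) as [HA|HA].
  - assert (0 <= B) by nra. assert (0 <= h ^ 5 * B) by nra. lra.
  (* The factor is negative here, so m may be replaced by its maximum 1/4; completing the square in
     A then absorbs the linear term in A. *)
  - assert (HB2 : (3298 / 10000 + A / 2) / 4 <= B) by nra.
    assert (h ^ 5 * ((3298 / 10000 + A / 2) / 4) <= h ^ 5 * B) by (apply Rmult_le_compat_l; lra).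
    assert (Sq : h / 4 * (A * h ^ 2 + 1 / 24) ^ 2 + h ^ 5 * ((3298 / 10000 + A / 2) / 4)
      = h / 4 * (A * h ^ 2 + 1 / 24 + h ^ 2 / 4) ^ 2 + h ^ 5 * (2673 / 40000) - h ^ 3 / 192) by field.
    assert (0 <= h / 4 * (A * h ^ 2 + 1 / 24 + h ^ 2 / 4) ^ 2)
      by (apply Rmult_le_pos; [lra | apply pow2_ge_0]).
    assert (0 <= F / 11520 + h ^ 5 * (2673 / 40000) - h ^ 3 / 192).
    { unfold F.
      assert (T := pow5_tangent h (4/10) ltac:(lra) ltac:(lra)).
      assert (0 <= h * (h ^ 2 - 16/100) ^ 2) by (apply Rmult_le_pos; [lra | apply pow2_ge_0]).
      nra. }
    lra.
Qed.

(* Without truncation the inequality fails for short intervals on which p' is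
   large; the level 7/4608 is 5/4 of the optimal cost 7/5760. *)
Definition clamp (v : R) : R := Rmax (- (7 / 4608)) (Rmin (7 / 4608) v).

Lemma clamp_bounds v : - (7 / 4608) <= clamp v <= 7 / 4608.
Proof. unfold clamp, Rmax, Rmin. repeat destruct Rle_dec; lra. Qed.

(** For |k| < 1/2 the untruncated inequality is [excess_flat]. If the excess is nonnegative, it
    survives truncation because [clamp] is monotone and 1-Lipschitz. If it is negative, truncation
    could lose something, and [excess_start], applied at both ends by reflection, together with
    [excess_simpson] makes up for it. *)
Lemma excess_ge_potential A k z q h : 0 < h -> nonpos_quartic A k z q ->
  clamp (end_potential A k z h) - clamp (start_potential A k z h) <= excess A q h.
Proof.
  intros Hh H.
  assert (H' := nonpos_quartic_flip _ _ _ _ H).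
  assert (B1 := clamp_bounds (end_potential A k z h)).
  assert (B0 := clamp_bounds (start_potential A k z h)).
  destruct (Rle_or_lt (1 / 2) k) as [Hk|Hk].
  { assert (K := excess_steep _ _ _ _ _ Hh H Hk). lra. }
  destruct (Rle_or_lt (1 / 2) (- k)) as [Hk'|Hk'].
  { assert (K := excess_steep _ _ _ _ _ Hh H' Hk'). lra. }
  assert (F := excess_flat _ _ _ _ _ Hh H ltac:(lra)).
  assert (S := excess_simpson _ _ _ _ _ Hh H).
  assert (S0 := excess_start _ _ _ _ _ Hh H). assert (S1 := excess_start _ _ _ _ _ Hh H').
  assert (E1 : start_potential A (- k) (- z) h = - end_potential A k z h)
    by (unfold start_potential, end_potential, left_slope, left_curvature; field).
  rewrite E1 in S1. clear E1 B1 B0.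
  destruct (Rle_or_lt 0 (excess A q h)) as [HG|HG].
  - clear S0 S1.
    unfold clamp, Rmax, Rmin. repeat destruct Rle_dec; lra.
  - specialize (S0 HG). specialize (S1 HG).
    unfold clamp, Rmax, Rmin. repeat destruct Rle_dec; lra.
Qed.

(** * Peano kernels of definite formulae *)

Lemma quad_ext N Q (HQ : is_quadrature N Q) (f g : R -> R) :
  (forall x, I01 x -> f x = g x) -> Q f = Q g.
Proof.
  destruct HQ as (a & tau & Ht & _ & E). intros H. rewrite !E.
  apply sum_n_m_ext_loc. intros i Hi. f_equal. apply H, Ht, Hi.
Qed.

Lemma quad_plus N Q (HQ : is_quadrature N Q) (f g : R -> R) :
  Q (fun x => f x + g x) = Q f + Q g.
Proof.
  destruct HQ as (a & tau & _ & _ & E). rewrite !E.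
  rewrite <- (sum_n_m_plus (G := R_AbelianMonoid)).
  apply sum_n_m_ext. intros i. unfold plus; simpl. ring.
Qed.

Lemma quad_scal N Q (HQ : is_quadrature N Q) (c : R) (f : R -> R) :
  Q (fun x => c * f x) = c * Q f.
Proof.
  destruct HQ as (a & tau & _ & _ & E). rewrite !E.
  rewrite <- (sum_n_m_mult_l (K := R_Ring)).
  apply sum_n_m_ext. intros i. unfold mult; simpl. ring.
Qed.

Lemma quad_bound N Q (HQ : is_quadrature N Q) : exists B, 0 <= B /\ forall f e, 0 <= e ->
  (forall x, I01 x -> Rabs (f x) <= e) -> Rabs (Q f) <= B * e.
Proof.
  destruct HQ as (a & tau & Ht & _ & E).
  exists (sum_n_m (fun i => Rabs (a i)) 1 N). split.
  - rewrite <- (Rmult_0_r (sum_n_m (fun i => Rabs (a i)) 1 N)).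
    rewrite <- (sum_n_m_mult_r (K := R_Ring)).
    apply sum_n_m_le. intros k. unfold mult; simpl. rewrite Rmult_0_r. apply Rabs_pos.
  - intros f e He H. rewrite E.
    eapply Rle_trans; [apply (norm_sum_n_m (K := R_AbsRing) (V := R_NormedModule))|].
    rewrite <- (sum_n_m_mult_r (K := R_Ring)).
    set (g := fun k => norm (a k * f (tau k))).
    (* [sum_n_m_le] compares terms at every index, but the nodes are known to lie in [0,1] only for
       1 <= k <= N; the other terms are set to 0. *)
    rewrite (sum_n_m_ext_loc g (fun k => if andb (Nat.leb 1 k) (Nat.leb k N) then g k else 0)).
    + apply sum_n_m_le. intros k. destruct (Nat.leb_spec 1 k), (Nat.leb_spec k N); simpl;
       try (apply Rmult_le_pos; [apply Rabs_pos | lra]).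
      unfold g, norm, mult; simpl. unfold abs; simpl. rewrite Rabs_mult.
      apply Rmult_le_compat_l; [apply Rabs_pos | apply H, Ht; lia].
    + intros k Hk. rewrite (proj2 (Nat.leb_le 1 k)), (proj2 (Nat.leb_le k N)) by lia. reflexivity.
Qed.

(** * Truncated powers and the sign of the Peano kernel *)

Definition ppart (x : R) : R := Rmax 0 x.

Lemma ppart_ge0 x : 0 <= ppart x. Proof. apply Rmax_l. Qed.
Lemma ppart_id x : 0 <= x -> ppart x = x. Proof. intros; apply Rmax_right; lra. Qed.
Lemma ppart_0 x : x <= 0 -> ppart x = 0. Proof. intros; apply Rmax_left; lra. Qed.

(** The exponent is at least 2, so the kink at u is smoothed: the difference quotient there is at
    most |h|^(n+1) in absolute value. *)
Lemma is_derive_ppart_pow n u x :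
  is_derive (fun x => ppart (x - u) ^ S (S n)) x (INR (S (S n)) * ppart (x - u) ^ S n).
Proof.
  destruct (Rtotal_order x u) as [Hx|[Hx|Hx]].
  - apply (is_derive_ext_loc (fun _ => 0)).
    + exists (mkposreal (u - x) ltac:(lra)). intros y Hy.
      unfold ball in Hy; simpl in Hy. unfold AbsRing_ball, abs, minus, plus, opp in Hy; simpl in Hy.
      apply Rabs_def2 in Hy. rewrite ppart_0 by lra. simpl; ring.
    + rewrite ppart_0 by lra. rewrite pow_i by lia. rewrite Rmult_0_r.
      apply (is_derive_const (K := R_AbsRing) (V := R_NormedModule) 0 x).
  - subst u. rewrite Rminus_diag, (ppart_0 0), pow_i, Rmult_0_r by (lra || lia).
    apply is_derive_Reals. intros e He.
    exists (mkposreal (Rmin 1 e) (Rmin_pos _ _ Rlt_0_1 He)). intros h Hh Hb. simpl in Hb.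
    replace (x + h - x) with h by ring. rewrite Rminus_diag, (ppart_0 0), (pow_i (S (S n))) by (lra || lia).
    assert (Hp : Rabs (ppart h) <= Rabs h).
    { unfold ppart, Rmax. destruct Rle_dec; [lra | rewrite Rabs_R0; apply Rabs_pos]. }
    assert (Hh1 : Rabs h < 1) by (eapply Rlt_le_trans; [exact Hb | apply Rmin_l]).
    assert (He1 : Rabs h < e) by (eapply Rlt_le_trans; [exact Hb | apply Rmin_r]).
    assert (Hpos : 0 < Rabs h) by (apply Rabs_pos_lt; exact Hh).
    replace ((ppart h ^ S (S n) - 0) / h - 0) with (ppart h ^ S n * (ppart h / h)) by (simpl; field; exact Hh).
    rewrite Rabs_mult, <- RPow_abs. unfold Rdiv. rewrite Rabs_mult, Rabs_inv.
    assert (Rabs (ppart h) * / Rabs h <= 1).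
    { apply (Rmult_le_reg_r (Rabs h)); [lra|]. rewrite Rmult_assoc, Rinv_l by lra. lra. }
    assert (Rabs (ppart h) ^ S n <= Rabs h).
    { simpl. rewrite <- (Rmult_1_r (Rabs h)).
      apply Rmult_le_compat; try apply Rabs_pos; [apply pow_le, Rabs_pos | exact Hp |].
      rewrite <- (pow1 n). apply pow_incr. split; [apply Rabs_pos | lra]. }
    assert (0 <= Rabs (ppart h) ^ S n) by (apply pow_le, Rabs_pos).
    apply Rle_lt_trans with (Rabs (ppart h) ^ S n * 1); [apply Rmult_le_compat_l; lra | lra].
  - apply (is_derive_ext_loc (fun x => (x - u) ^ S (S n))).
    + exists (mkposreal (x - u) ltac:(lra)). intros y Hy.
      unfold ball in Hy; simpl in Hy. unfold AbsRing_ball, abs, minus, plus, opp in Hy; simpl in Hy.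
      apply Rabs_def2 in Hy. rewrite ppart_id by lra. reflexivity.
    + rewrite ppart_id by lra.
      assert (D : is_derive (fun x => x - u) x 1) by (auto_derive; [trivial | ring]).
      assert (D' := is_derive_pow (fun x => x - u) (S (S n)) x 1 D).
      rewrite Rmult_1_r in D'. exact D'.
Qed.

Lemma continuous_ppart x : continuous ppart x.
Proof.
  assert (E : forall y : R, (y + Rabs y) / 2 = ppart y).
  { intros y. unfold ppart, Rmax.
    destruct Rle_dec; [rewrite Rabs_pos_eq by lra | rewrite Rabs_left by lra]; field. }
  apply (continuous_ext (fun x => (x + Rabs x) / 2)); [exact E|].
  apply (continuous_mult (K := R_AbsRing)).
  - apply (continuous_plus (V := R_NormedModule)); [apply continuous_id | apply continuous_Rabs].
  - apply continuous_const.
Qed.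

Lemma Cr01_of_is_derive (f f1 f2 f3 f4 : R -> R) :
  (forall x, is_derive f x (f1 x)) -> (forall x, is_derive f1 x (f2 x)) ->
  (forall x, is_derive f2 x (f3 x)) -> (forall x, is_derive f3 x (f4 x)) ->
  (forall x, continuous f4 x) -> Cr01 4 f f4.
Proof.
  intros H0 H1 H2 H3 H4.
  assert (D : forall g g', (forall x, is_derive g x (g' x)) -> forall x, I01 x -> D_in g g' I01 x).
  { intros g g' H x _. apply (D_in_imp g g' no_cond); [intros; exact I|].
    apply derivable_pt_lim_D_in, is_derive_Reals, H. }
  split.
  - simpl. exists f1; split; [apply D, H0|]. exists f2; split; [apply D, H1|].
    exists f3; split; [apply D, H2|]. exists f4; split; [apply D, H3|]. reflexivity.
  - intros x _. assert (C := H4 x). apply continuity_pt_filterlim in C.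
    intros e He. destruct (C e He) as (d & Hd & K). exists d; split; [exact Hd|].
    intros y [[_ Hy] Hy2]. apply K. split; [split; [exact I | exact Hy] | exact Hy2].
Qed.

Definition diff2 (f : R -> R) (e : R) : R := f 0 - 2 * f (- e) + f (- (2 * e)).

(** The main term comes from (y^5)'' = 20 y^3. For y > 2 e the difference is an explicit polynomial;
    for 0 < y <= 2 e every term is of order e^5. *)
Lemma diff2_ppart5 y e : y <= 1 -> 0 < e <= 1 ->
  Rabs (diff2 (fun s => ppart (y + s) ^ 5) e - 20 * e ^ 2 * ppart y ^ 3) <= 300 * e ^ 3.
Proof.
  intros Hy He. unfold diff2. rewrite Rplus_0_r.
  assert (0 < e ^ 3) by (apply pow_lt; lra).
  assert (Hk : forall k, e ^ S k <= e ^ k).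
  { intros k. simpl. assert (0 <= e ^ k) by (apply pow_le; lra). nra. }
  assert (E4 := Hk 3%nat). assert (E5 := Hk 4%nat).
  assert (0 < e ^ 4) by (apply pow_lt; lra). assert (0 < e ^ 5) by (apply pow_lt; lra).
  destruct (Rle_or_lt y 0) as [Hn|Hn].
  { rewrite !ppart_0 by lra. apply Rabs_le. simpl. nra. }
  destruct (Rle_or_lt y (2 * e)) as [Hm|Hm].
  - assert (B : forall s m, 0 <= s -> 0 <= ppart (y + - s) ^ m <= (2 * e) ^ m).
    { intros s m Hs. split; [apply pow_le, ppart_ge0|]. apply pow_incr. split; [apply ppart_ge0|].
      unfold ppart. apply Rmax_lub; lra. }
    assert (B0 := B 0 5%nat ltac:(lra)). assert (B1 := B e 5%nat ltac:(lra)).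
    assert (B2 := B (2 * e) 5%nat ltac:(lra)). assert (B3 := B 0 3%nat ltac:(lra)).
    rewrite Ropp_0, Rplus_0_r in B0, B3. rewrite Rpow_mult_distr in B0, B1, B2, B3.
    assert (20 * e ^ 2 * ppart y ^ 3 <= 160 * e ^ 5).
    { replace (160 * e ^ 5) with (20 * e ^ 2 * (2 ^ 3 * e ^ 3)) by ring.
      apply Rmult_le_compat_l; [nra | lra]. }
    assert (0 <= 20 * e ^ 2 * ppart y ^ 3) by (apply Rmult_le_pos; [nra | lra]).
    simpl (2 ^ 5) in *. apply Rabs_le. lra.
  - rewrite !ppart_id by lra.
    replace (_ - _) with (e ^ 3 * (- 60 * y ^ 2 + 70 * y * e - 30 * e ^ 2)) by ring.
    rewrite Rabs_mult, (Rabs_pos_eq (e ^ 3)) by lra. rewrite Rmult_comm.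
    apply Rmult_le_compat_r; [lra|]. apply Rabs_le. nra.
Qed.

Lemma is_RInt_ppart5 u : 0 <= u <= 1 -> is_RInt (fun x => ppart (x - u) ^ 5) 0 1 ((1 - u) ^ 6 / 6).
Proof.
  intros Hu.
  assert (D : forall x, is_derive (fun x => / 6 * ppart (x - u) ^ 6) x (ppart (x - u) ^ 5)).
  { intros x. assert (D := is_derive_scal _ x (/ 6) _ (is_derive_ppart_pow 4 u x)).
    replace (ppart (x - u) ^ 5) with (/ 6 * (INR 6 * ppart (x - u) ^ 5)) by (simpl INR; field). exact D. }
  replace ((1 - u) ^ 6 / 6) with (minus (/ 6 * ppart (1 - u) ^ 6) (/ 6 * ppart (0 - u) ^ 6)).
  - apply (is_RInt_derive (V := R_CompleteNormedModule) (fun x => / 6 * ppart (x - u) ^ 6)).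
    + intros x _. apply D.
    + intros x _. apply (ex_derive_continuous (K := R_AbsRing) (V := R_NormedModule)).
      eexists. apply (is_derive_ppart_pow 3).
  - unfold minus, plus, opp; simpl. rewrite (ppart_id (1 - u)), (ppart_0 (0 - u)) by lra. field.
Qed.

Lemma Cr01_diff2_ppart5 t e : 0 < e -> Cr01 4
  (fun x => 1 * ppart (x - t) ^ 5 + (- 2 * ppart (x - (t + e)) ^ 5 + 1 * ppart (x - (t + 2 * e)) ^ 5))
  (fun x => 120 * (1 * ppart (x - t) ^ 1 + (- 2 * ppart (x - (t + e)) ^ 1 + 1 * ppart (x - (t + 2 * e)) ^ 1))).
Proof.
  intros He.
  set (w := fun n x => 1 * ppart (x - t) ^ n + (- 2 * ppart (x - (t + e)) ^ n + 1 * ppart (x - (t + 2 * e)) ^ n)).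
  assert (D : forall a n x,
    is_derive (fun x => a * w (S (S n)) x) x (a * INR (S (S n)) * w (S n) x)).
  { intros a n x. rewrite Rmult_assoc. apply is_derive_scal.
    set (c := INR (S (S n))).
    replace (c * w (S n) x) with (1 * (c * ppart (x - t) ^ S n)
      + (- 2 * (c * ppart (x - (t + e)) ^ S n) + 1 * (c * ppart (x - (t + 2 * e)) ^ S n)))
      by (unfold w; ring).
    unfold w. apply (is_derive_plus (K := R_AbsRing) (V := R_NormedModule));
      [|apply (is_derive_plus (K := R_AbsRing) (V := R_NormedModule))];
      apply is_derive_scal, is_derive_ppart_pow. }
  assert (E : forall (f g : R -> R) (f' x : R), (forall y, f y = g y) -> is_derive g x f' -> is_derive f x f').
  { intros f g f' x H. apply is_derive_ext. intros y; symmetry; apply H. }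
  eapply Cr01_of_is_derive.
  - intros x. eapply E; [|apply (D 1 3%nat)]. intros y. unfold w. ring.
  - intros x. apply (D _ 2%nat).
  - intros x. apply (D _ 1%nat).
  - intros x.
    replace (120 * _) with (1 * INR 5 * INR 4 * INR 3 * INR 2 * w 1%nat x)
      by (unfold w; simpl INR; ring).
    apply (D _ 0%nat).
  - assert (C : forall u x, continuous (fun x => ppart (x - u) ^ 1) x).
    { intros u x. apply (continuous_ext (fun x => ppart (x - u))); [intros; simpl; symmetry; apply Rmult_1_r|].
      apply (continuous_comp (fun x => x - u) ppart); [|apply continuous_ppart].
      apply (ex_derive_continuous (K := R_AbsRing) (V := R_NormedModule)). auto_derive; trivial. }
    assert (M : forall a (g : R -> R) x, continuous g x -> continuous (fun x => a * g x) x).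
    { intros a g x Hg.
      apply (continuous_mult (K := R_AbsRing) (fun _ => a) g); [apply continuous_const | exact Hg]. }
    assert (P : forall (g k : R -> R) x, continuous g x -> continuous k x ->
      continuous (fun x => g x + k x) x)
      by (intros g k x; apply (continuous_plus (V := R_NormedModule) g k)).
    intros x. apply M, P; [apply M, C | apply P; apply M, C].
Qed.

(* Since (x - t)_+^3 is not C^4, it is approximated by second differences of
   (x - t)_+^5, whose fourth derivatives are nonnegative hat functions. *)
Lemma kernel_nonpos N Q c t : is_quadrature N Q -> negative_definite 4 Q c -> 0 <= t < 1 ->
  (1 - t) ^ 4 / 24 - Q (fun x => ppart (x - t) ^ 3) / 6 <= 0.
Proof.
  intros HQ [Hc Hneg] Ht.
  destruct (quad_bound _ _ HQ) as (B & HB & Hbound).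
  (* The remainder of the second difference is nonpositive. Divided by 120 e^2 it equals the kernel
     at t up to (3 B + 1) e, which vanishes as e tends to 0. *)
  assert (Main : forall e, 0 < e <= 1 -> t + 2 * e <= 1 ->
    (1 - t) ^ 4 / 24 - Q (fun x => ppart (x - t) ^ 3) / 6 <= (3 * B + 1) * e).
  { intros e He Hte.
    destruct (Hneg _ _ (Cr01_diff2_ppart5 t e ltac:(lra))) as (xi & _ & HR).
    set (f := fun x => 1 * ppart (x - t) ^ 5
       + (- 2 * ppart (x - (t + e)) ^ 5 + 1 * ppart (x - (t + 2 * e)) ^ 5)) in *.
    assert (Hhat : 0 <= 120 * (1 * ppart (xi - t) ^ 1
       + (- 2 * ppart (xi - (t + e)) ^ 1 + 1 * ppart (xi - (t + 2 * e)) ^ 1))).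
    { unfold ppart, Rmax. repeat destruct Rle_dec; lra. }
    assert (HR0 : remainder Q f <= 0) by (rewrite HR; nra). clear HR Hhat.
    assert (HI : RInt f 0 1 = 1 * ((1 - t) ^ 6 / 6)
       + (- 2 * ((1 - (t + e)) ^ 6 / 6) + 1 * ((1 - (t + 2 * e)) ^ 6 / 6))).
    { apply is_RInt_unique. unfold f.
      apply (is_RInt_plus (V := R_NormedModule)); [|apply (is_RInt_plus (V := R_NormedModule))];
      apply (is_RInt_scal (V := R_NormedModule)), is_RInt_ppart5; lra. }
    assert (HQf : Q f = 20 * e ^ 2 * Q (fun x => ppart (x - t) ^ 3)
       + Q (fun x => diff2 (fun s => ppart (x - t + s) ^ 5) e - 20 * e ^ 2 * ppart (x - t) ^ 3)).
    { rewrite <- (quad_scal _ _ HQ), <- (quad_plus _ _ HQ). apply (quad_ext _ _ HQ).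
      intros x _. unfold f, diff2.
      replace (x - t + 0) with (x - t) by ring. replace (x - t + - e) with (x - (t + e)) by ring.
      replace (x - t + - (2 * e)) with (x - (t + 2 * e)) by ring. ring. }
    assert (He3 : 0 < e ^ 3) by (apply pow_lt; lra).
    assert (Hb := Hbound _ (300 * e ^ 3) ltac:(lra)
       (fun x (Hx : I01 x) => diff2_ppart5 (x - t) e ltac:(destruct Hx; lra) He)).
    apply Rabs_le_between in Hb.
    unfold remainder in HR0. rewrite HI, HQf in HR0.
    set (q3 := Q (fun x => ppart (x - t) ^ 3)) in *.
    match type of Hb with _ <= ?z <= _ => set (Z := z) in * end. clearbody Z q3.
    set (y := 1 - t) in *.
    replace (1 - (t + e)) with (y - e) in HR0 by (unfold y; ring).
    replace (1 - (t + 2 * e)) with (y - 2 * e) in HR0 by (unfold y; ring).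
    assert (Hy : 2 * e <= y <= 1) by (unfold y; lra). clearbody y.
    assert (P : 30 * e ^ 2 * y ^ 4 - 300 * e ^ 3 <= 1 * y ^ 6 - 2 * (y - e) ^ 6 + 1 * (y - 2 * e) ^ 6).
    { assert (Eq : 1 * y ^ 6 - 2 * (y - e) ^ 6 + 1 * (y - 2 * e) ^ 6 - (30 * e ^ 2 * y ^ 4 - 300 * e ^ 3)
        = e ^ 3 * (300 - 120 * y ^ 3 + 210 * y ^ 2 * e - 180 * y * e ^ 2 + 62 * e ^ 3)) by ring.
      assert (0 <= y ^ 3 <= 1) by (split; [apply pow_le; lra | rewrite <- (pow1 3); apply pow_incr; lra]).
      assert (0 <= y ^ 2 * e) by (apply Rmult_le_pos; [apply pow2_ge_0 | lra]).
      assert (e ^ 2 <= 1) by nra. assert (0 <= y * e ^ 2 <= 1) by (split; nra).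
      assert (0 <= e ^ 3 * (300 - 120 * y ^ 3 + 210 * y ^ 2 * e - 180 * y * e ^ 2 + 62 * e ^ 3))
        by (apply Rmult_le_pos; lra).
      lra. }
    assert (Hfin : e ^ 2 * (y ^ 4 / 24 - q3 / 6) <= e ^ 2 * ((3 * B + 1) * e)).
    { assert (0 <= B * e ^ 3) by (apply Rmult_le_pos; lra).
      replace (e ^ 2 * ((3 * B + 1) * e)) with (3 * (B * e ^ 3) + e ^ 3) by ring.
      lra. }
    apply Rmult_le_reg_l in Hfin; [exact Hfin | apply pow_lt; lra]. }
  apply Rnot_lt_le. intros HK. set (K := _ - _) in *.
  set (e := Rmin ((1 - t) / 2) (K / (2 * (3 * B + 1)))).
  assert (He0 : 0 < e) by (apply Rmin_pos; [lra | apply Rdiv_lt_0_compat; lra]).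
  assert (He1 : e <= (1 - t) / 2) by apply Rmin_l.
  assert (He2 : e <= K / (2 * (3 * B + 1))) by apply Rmin_r.
  assert (M := Main e ltac:(lra) ltac:(lra)).
  assert ((3 * B + 1) * e <= K / 2).
  { replace (K / 2) with ((3 * B + 1) * (K / (2 * (3 * B + 1)))) by (field; lra).
    apply Rmult_le_compat_l; lra. }
  lra.
Qed.

(** * The upper bound on error constants *)

(** Here d1 and d2 are K' and K'' at a knot. Since K scales like the fourth power of length, they
    carry the factors e^3 and e^2. *)
Definition potential (e d1 d2 : R) : R :=
  clamp (- (1 / 4) * (e ^ 3 * d1) * (e ^ 2 * d2 + 1 / 12)).

Lemma quartic_potential_step e L p0 p1 p2 p3 : 0 < e -> 0 <= L ->
  (forall x, 0 <= x <= L -> p0 + p1 * x + p2 * x ^ 2 / 2 + p3 * x ^ 3 / 6 + x ^ 4 / 24 <= 0) ->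
  potential e (p1 + p2 * L + p3 * L ^ 2 / 2 + L ^ 3 / 6) (p2 + p3 * L + L ^ 2 / 2) - potential e p1 p2
  <= - e ^ 5 * (p0 * L + p1 * L ^ 2 / 2 + p2 * L ^ 3 / 6 + p3 * L ^ 4 / 24 + L ^ 5 / 120)
     - 7 / 5760 * (5 * (e * L) - 4).
Proof.
  intros He [HL|<-] H.
  (* The numbers q, k, A, z are the value and the first three derivatives at the midpoint, in units
     of the length L. *)
  - set (z := (p3 + L / 2) / L).
    set (A := (p2 + p3 * L / 2 + L ^ 2 / 8) / L ^ 2).
    set (k := (p1 + p2 * L / 2 + p3 * L ^ 2 / 8 + L ^ 3 / 48) / L ^ 3).
    set (q := (p0 + p1 * L / 2 + p2 * L ^ 2 / 8 + p3 * L ^ 3 / 48 + L ^ 4 / 384) / L ^ 4).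
    assert (HP : nonpos_quartic A k z q).
    { intros y Hy. unfold centered_quartic.
      assert (HL4 : 0 < L ^ 4) by (apply pow_lt; lra).
      apply (Rmult_le_reg_l (L ^ 4)); [exact HL4|]. rewrite Rmult_0_r.
      eapply Rle_trans; [|apply (H (L * (y + 1 / 2))); split; nra].
      right. unfold A, k, z, q. field. lra. }
    assert (T := excess_ge_potential A k z q (e * L) ltac:(nra) HP).
    unfold potential.
    replace (- (1 / 4) * (e ^ 3 * (p1 + p2 * L + p3 * L ^ 2 / 2 + L ^ 3 / 6))
        * (e ^ 2 * (p2 + p3 * L + L ^ 2 / 2) + 1 / 12))
      with (end_potential A k z (e * L)) by (unfold end_potential, A, k, z; field; lra).
    replace (- (1 / 4) * (e ^ 3 * p1) * (e ^ 2 * p2 + 1 / 12))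
      with (start_potential A k z (e * L))
      by (unfold start_potential, left_slope, left_curvature, A, k, z; field; lra).
    eapply Rle_trans; [exact T|]. right. unfold excess, neg_integral, A, q. field. lra.
  - replace (p1 + p2 * 0 + p3 * 0 ^ 2 / 2 + 0 ^ 3 / 6) with p1 by field.
    replace (p2 + p3 * 0 + 0 ^ 2 / 2) with p2 by field. lra.
Qed.

(* Q has no node in the open interval (s, s'). *)
Definition gap (Q : functional) (s s' : R) : Prop := forall f g : R -> R,
  (forall y, I01 y -> y <= s \/ s' <= y -> f y = g y) -> Q f = Q g.

(* The Peano kernel, its first two derivatives, and an antiderivative. *)
Definition kern0 (Q : functional) t := (1 - t) ^ 4 / 24 - Q (fun y => ppart (y - t) ^ 3) / 6.
Definition kern1 (Q : functional) t := - (1 - t) ^ 3 / 6 + Q (fun y => ppart (y - t) ^ 2) / 2.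
Definition kern2 (Q : functional) t := (1 - t) ^ 2 / 2 - Q (fun y => ppart (y - t) ^ 1).
Definition kernI (Q : functional) t := - (1 - t) ^ 5 / 120 + Q (fun y => ppart (y - t) ^ 4) / 24.

(** For y outside the gap, each truncated power of y - (s + x) is a polynomial in x with
    coefficients built from powers of (y - s)_+. Applying Q shows that the kernel is a quartic on
    the gap, with third derivative -(1 - s) + Q[th] at s, so [quartic_potential_step] applies. *)
Lemma kernel_gap_step N Q c e s s' : is_quadrature N Q -> negative_definite 4 Q c ->
  0 < e -> 0 <= s -> s <= s' -> s' <= 1 -> gap Q s s' ->
  potential e (kern1 Q s') (kern2 Q s') - potential e (kern1 Q s) (kern2 Q s)
  <= - e ^ 5 * (kernI Q s' - kernI Q s) - 7 / 5760 * (5 * (e * (s' - s)) - 4).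
Proof.
  (* A node at 0 or 1 makes an interval degenerate; the claim is then 0 <= 4 * 7/5760. *)
  intros HQ Hneg He Hs [Hss|<-] Hs' Hgap; [|lra].
  (* [th] plays the role of (y - s)_+^0, because [ppart (y - s) ^ 0] is 1 even to the left of s. *)
  set (th := fun y => if Rle_dec s' y then 1 else 0).
  assert (comb : forall a1 a2 a3 a4 a5 (f1 f2 f3 f4 f5 : R -> R),
    Q (fun y => a1 * f1 y + (a2 * f2 y + (a3 * f3 y + (a4 * f4 y + a5 * f5 y))))
      = a1 * Q f1 + (a2 * Q f2 + (a3 * Q f3 + (a4 * Q f4 + a5 * Q f5)))).
  { intros. rewrite !(quad_plus _ _ HQ), !(quad_scal _ _ HQ). reflexivity. }
  assert (shift : forall x y, 0 <= x <= s' - s -> y <= s \/ s' <= y ->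
     ppart (y - (s + x)) = ppart (y - s) - x * th y /\
     ppart (y - s) * th y = ppart (y - s) /\ th y * th y = th y).
  { intros x y Hx Hy. unfold th. destruct (Rle_dec s' y).
    - rewrite !ppart_id by lra. split; [|split]; ring.
    - rewrite !ppart_0 by lra. split; [|split]; ring. }
  set (m1 := Q (fun y => ppart (y - s) ^ 1)). set (m2 := Q (fun y => ppart (y - s) ^ 2)).
  set (m3 := Q (fun y => ppart (y - s) ^ 3)). set (m4 := Q (fun y => ppart (y - s) ^ 4)).
  assert (S1 : forall x, 0 <= x <= s' - s -> Q (fun y => ppart (y - (s + x)) ^ 1) = m1 - x * Q th).
  { intros x Hx.
    rewrite (Hgap _ (fun y => 1 * (ppart (y - s) ^ 1) + (- x * th y + (0 * th y + (0 * th y + 0 * th y))))).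
    - rewrite comb. fold m1. ring.
    - intros y _ Hy. destruct (shift x y Hx Hy) as (E & _). rewrite E. ring. }
  assert (S2 : forall x, 0 <= x <= s' - s -> Q (fun y => ppart (y - (s + x)) ^ 2) = m2 - 2 * x * m1 + x ^ 2 * Q th).
  { intros x Hx.
    rewrite (Hgap _ (fun y => 1 * (ppart (y - s) ^ 2) + (- 2 * x * (ppart (y - s) ^ 1)
       + (x ^ 2 * th y + (0 * th y + 0 * th y))))).
    - rewrite comb. fold m1 m2. ring.
    - intros y _ Hy. destruct (shift x y Hx Hy) as (E & E1 & E2). rewrite E.
      replace ((ppart (y - s) - x * th y) ^ 2)
        with (ppart (y - s) ^ 2 - 2 * x * (ppart (y - s) * th y) + x ^ 2 * (th y * th y)) by ring.
      rewrite E1, E2. ring. }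
  assert (S3 : forall x, 0 <= x <= s' - s -> Q (fun y => ppart (y - (s + x)) ^ 3)
      = m3 - 3 * x * m2 + 3 * x ^ 2 * m1 - x ^ 3 * Q th).
  { intros x Hx.
    rewrite (Hgap _ (fun y => 1 * (ppart (y - s) ^ 3) + (- 3 * x * (ppart (y - s) ^ 2)
       + (3 * x ^ 2 * (ppart (y - s) ^ 1) + (- x ^ 3 * th y + 0 * th y))))).
    - rewrite comb. fold m1 m2 m3. ring.
    - intros y _ Hy. destruct (shift x y Hx Hy) as (E & E1 & E2). rewrite E.
      replace ((ppart (y - s) - x * th y) ^ 3)
        with (ppart (y - s) ^ 3 - 3 * x * ppart (y - s) * (ppart (y - s) * th y)
              + 3 * x ^ 2 * (ppart (y - s) * (th y * th y)) - x ^ 3 * (th y * (th y * th y))) by ring.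
      rewrite ?E2, ?E1, ?E2. ring. }
  assert (S4 : forall x, 0 <= x <= s' - s -> Q (fun y => ppart (y - (s + x)) ^ 4)
      = m4 - 4 * x * m3 + 6 * x ^ 2 * m2 - 4 * x ^ 3 * m1 + x ^ 4 * Q th).
  { intros x Hx.
    rewrite (Hgap _ (fun y => 1 * (ppart (y - s) ^ 4) + (- 4 * x * (ppart (y - s) ^ 3)
       + (6 * x ^ 2 * (ppart (y - s) ^ 2) + (- 4 * x ^ 3 * (ppart (y - s) ^ 1) + x ^ 4 * th y))))).
    - rewrite comb. fold m1 m2 m3 m4. ring.
    - intros y _ Hy. destruct (shift x y Hx Hy) as (E & E1 & E2). rewrite E.
      replace ((ppart (y - s) - x * th y) ^ 4)
        with (ppart (y - s) ^ 4 - 4 * x * ppart (y - s) ^ 2 * (ppart (y - s) * th y)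
              + 6 * x ^ 2 * (ppart (y - s) * (ppart (y - s) * (th y * th y)))
              - 4 * x ^ 3 * (ppart (y - s) * (th y * (th y * th y)))
              + x ^ 4 * (th y * (th y * (th y * th y)))) by ring.
      rewrite ?E2, ?E1, ?E2, ?E1. ring. }
  set (L := s' - s).
  assert (HL : 0 < L) by (unfold L; lra).
  assert (Hk : forall x, 0 <= x <= L ->
    kern0 Q s + kern1 Q s * x + kern2 Q s * x ^ 2 / 2 + (- (1 - s) + Q th) * x ^ 3 / 6 + x ^ 4 / 24 <= 0).
  { assert (lt1 : forall x, 0 <= x <= L -> s + x < 1 ->
      kern0 Q s + kern1 Q s * x + kern2 Q s * x ^ 2 / 2 + (- (1 - s) + Q th) * x ^ 3 / 6 + x ^ 4 / 24 <= 0).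
    { intros x Hx Hx1. assert (K := kernel_nonpos N Q c (s + x) HQ Hneg ltac:(lra)).
      rewrite S3 in K by exact Hx. unfold kern0, kern1, kern2. fold m1 m2 m3. lra. }
    (* The point s + x = 1 is outside the range of [kernel_nonpos]; there the kernel is 0, as (y -
       1)_+^3 vanishes on [0,1]. *)
    intros x Hx. destruct (Rlt_or_le (s + x) 1) as [H1|H1]; [apply lt1; assumption|].
    right. assert (Es : s' = 1) by (unfold L in Hx; lra).
    assert (Ex : x = 1 - s) by (unfold L in Hx; lra).
    assert (Z : Q (fun y => ppart (y - (s + x)) ^ 3) = 0).
    { rewrite <- (Rmult_0_l (Q th)), <- (quad_scal _ _ HQ). apply (quad_ext _ _ HQ).
      intros y Hy. rewrite ppart_0 by (destruct Hy; lra). ring. }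
    rewrite S3 in Z by exact Hx.
    unfold kern0, kern1, kern2. fold m1 m2 m3.
    replace m3 with (3 * x * m2 - 3 * x ^ 2 * m1 + x ^ 3 * Q th) by lra.
    rewrite Ex. field. }
  assert (T := quartic_potential_step e L _ _ _ _ He ltac:(lra) Hk).
  assert (HL' : 0 <= L <= s' - s) by (unfold L; lra).
  assert (Es' : s' = s + L) by (unfold L; ring).
  replace (kern1 Q s') with (kern1 Q s + kern2 Q s * L + (- (1 - s) + Q th) * L ^ 2 / 2 + L ^ 3 / 6).
  2:{ rewrite Es'. unfold kern1, kern2. rewrite (S2 L HL'). fold m1 m2. field. }
  replace (kern2 Q s') with (kern2 Q s + (- (1 - s) + Q th) * L + L ^ 2 / 2).
  2:{ rewrite Es'. unfold kern2. rewrite (S1 L HL'). fold m1. field. }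
  eapply Rle_trans; [exact T|]. right.
  replace (kernI Q s') with (kernI Q s + (kern0 Q s * L + kern1 Q s * L ^ 2 / 2 + kern2 Q s * L ^ 3 / 6 +
    (- (1 - s) + Q th) * L ^ 4 / 24 + L ^ 5 / 120)).
  2:{ rewrite Es'. unfold kernI, kern0, kern1, kern2. rewrite (S4 L HL'). fold m1 m2 m3 m4. field. }
  ring.
Qed.

Lemma RInt_pow01 n : RInt (fun x => x ^ n) 0 1 = / INR (S n).
Proof.
  apply is_RInt_unique.
  assert (Hn : INR (S n) <> 0) by (apply not_0_INR; lia).
  replace (/ INR (S n)) with (minus (/ INR (S n) * 1 ^ S n) (/ INR (S n) * 0 ^ S n)).
  2:{ change (/ INR (S n) * 1 ^ S n - / INR (S n) * 0 ^ S n = / INR (S n)). rewrite pow1, pow_i by lia. ring. }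
  apply (is_RInt_derive (V := R_CompleteNormedModule) (fun x => / INR (S n) * x ^ S n)).
  - intros x _.
    replace (x ^ n) with (/ INR (S n) * (INR (S n) * 1 * x ^ n)) by (field; exact Hn).
    apply is_derive_scal. apply (is_derive_pow (fun x => x) (S n) x 1). auto_derive; trivial.
  - intros x _. apply (ex_derive_continuous (K := R_AbsRing) (V := R_NormedModule)).
    auto_derive; trivial.
Qed.

(** In terms of the kernel: K'(0) = K''(0) = 0, and K has integral c. *)
Lemma moments_of_negative_definite Q c : negative_definite 4 Q c ->
  Q (fun x => x ^ 1) = 1 / 2 /\ Q (fun x => x ^ 2) = 1 / 3 /\
  1 / 120 - Q (fun x => x ^ 4) / 24 = c.
Proof.
  intros [_ H].
  assert (Z : forall x, continuous (fun _ : R => 0) x) by (intros; apply continuous_const).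
  assert (R1 : remainder Q (fun x => x ^ 1) = 0).
  { destruct (H (fun x => x ^ 1) (fun _ => 0)) as (xi & _ & E).
    - apply (Cr01_of_is_derive _ (fun _ => 1) (fun _ => 0) (fun _ => 0)); try exact Z; intros x; auto_derive; trivial; ring.
    - rewrite E; ring. }
  assert (R2 : remainder Q (fun x => x ^ 2) = 0).
  { destruct (H (fun x => x ^ 2) (fun _ => 0)) as (xi & _ & E).
    - apply (Cr01_of_is_derive _ (fun x => 2 * x) (fun _ => 2) (fun _ => 0)); try exact Z; intros x; auto_derive; trivial; ring.
    - rewrite E; ring. }
  assert (R4 : remainder Q (fun x => x ^ 4) = c * 24).
  { destruct (H (fun x => x ^ 4) (fun _ => 24)) as (xi & _ & E).
    - apply (Cr01_of_is_derive _ (fun x => 4 * x ^ 3) (fun x => 12 * x ^ 2) (fun x => 24 * x));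
        try (intros x; apply continuous_const); intros x; auto_derive; trivial; ring.
    - exact E. }
  unfold remainder in *. rewrite RInt_pow01 in R1, R2, R4. simpl INR in *.
  repeat split; lra.
Qed.

Lemma error_constant_upper_bound N Q c : is_quadrature N Q -> negative_definite 4 Q c ->
  c <= - (7 / 5760) / (INR N + 1) ^ 4.
Proof.
  intros HQ Hneg.
  destruct (moments_of_negative_definite _ _ Hneg) as (M1 & M2 & M4).
  assert (HQ' := HQ). destruct HQ' as (a & tau & Ht & Hord & EQ).
  set (e := INR N + 1). assert (He : 0 < e) by (assert (H := pos_INR N); unfold e; lra).
  (* The nodes are padded by 0 at index 0 and 1 at index N + 1, which gives N + 1 possibly
     degenerate intervals. *)
  set (s := fun i => match i with O => 0 | S _ => if Nat.leb i N then tau i else 1 end).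
  assert (Hs01 : forall i, 0 <= s i <= 1).
  { intros [|i]; unfold s; [lra|]. destruct (Nat.leb_spec (S i) N); [apply Ht; lia | lra]. }
  assert (Hsmon : forall i, s i <= s (S i)).
  { intros [|i]; unfold s.
    - destruct (Nat.leb_spec 1 N); [apply Ht; lia | lra].
    - destruct (Nat.leb_spec (S (S i)) N), (Nat.leb_spec (S i) N); try lia; try lra.
      + left; apply Hord; lia.
      + apply Ht; lia. }
  assert (Hgap : forall i, (i <= N)%nat -> gap Q (s i) (s (S i))).
  { intros i Hi f g H. rewrite !EQ. apply sum_n_m_ext_loc. intros j Hj. f_equal. apply H; [apply Ht; exact Hj|].
    assert (mono : forall j k, (1 <= j)%nat -> (j <= k)%nat -> (k <= N)%nat -> tau j <= tau k).
    { intros j' k' H1 H2 H3. destruct (Nat.eq_dec j' k') as [->|]; [lra | left; apply Hord; lia]. }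
    destruct (Nat.le_gt_cases j i) as [Hji|Hji].
    - left. destruct i; [lia|]. unfold s. rewrite (proj2 (Nat.leb_le (S i) N)) by lia. apply mono; lia.
    - right. unfold s. rewrite (proj2 (Nat.leb_le (S i) N)) by lia. apply mono; lia. }
  assert (Ind : forall i, (i <= S N)%nat ->
    potential e (kern1 Q (s i)) (kern2 Q (s i)) - potential e (kern1 Q 0) (kern2 Q 0)
    <= - e ^ 5 * (kernI Q (s i) - kernI Q 0) - 7 / 5760 * (5 * (e * s i) - 4 * INR i)).
  { induction i as [|i IH]; intros Hi.
    - simpl. lra.
    - specialize (IH ltac:(lia)).
      assert (T := kernel_gap_step N Q c e (s i) (s (S i)) HQ Hneg He
         (proj1 (Hs01 i)) (Hsmon i) (proj2 (Hs01 (S i))) (Hgap i ltac:(lia))).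
      rewrite S_INR. lra. }
  assert (Hend : s (S N) = 1).
  { unfold s. destruct (Nat.leb_spec (S N) N); [lia | reflexivity]. }
  specialize (Ind (S N) ltac:(lia)). rewrite Hend, S_INR in Ind.
  assert (P0 : forall n, Q (fun y => ppart (y - 0) ^ n) = Q (fun y => y ^ n)).
  { intros n. apply (quad_ext _ _ HQ). intros y [Hy _]. rewrite Rminus_0_r, ppart_id by lra. reflexivity. }
  assert (P1 : forall n, Q (fun y => ppart (y - 1) ^ S n) = 0).
  { intros n. rewrite <- (Rmult_0_l (Q (fun _ => 0))), <- (quad_scal _ _ HQ). apply (quad_ext _ _ HQ).
    intros y [_ Hy]. rewrite ppart_0, pow_i by (lra || lia). ring. }
  unfold kern1, kern2, kernI in Ind. rewrite !P0, !P1, M1, M2 in Ind.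
  replace (- (1 - 1) ^ 3 / 6 + 0 / 2) with 0 in Ind by field.
  replace ((1 - 1) ^ 2 / 2 - 0) with 0 in Ind by field.
  replace (- (1 - 0) ^ 3 / 6 + 1 / 3 / 2) with 0 in Ind by field.
  replace ((1 - 0) ^ 2 / 2 - 1 / 2) with 0 in Ind by field.
  (* The potentials at 0 and 1 coincide and cancel, and the tangent terms add up to 5 e - 4 (N + 1)
     = e. *)
  assert (F : e ^ 5 * c <= - (7 / 5760) * e) by (fold e in Ind; nra).
  assert (He4 : 0 < e ^ 4) by (apply pow_lt; lra).
  apply (Rmult_le_reg_r (e * e ^ 4)); [nra|].
  replace (- (7 / 5760) / e ^ 4 * (e * e ^ 4)) with (- (7 / 5760) * e) by (field; lra).
  replace (c * (e * e ^ 4)) with (e ^ 5 * c) by ring. exact F.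
Qed.

(** * Peano kernel of the given formula *)

(** Derivatives are asked for only inside (0,1): a function on [0,1] extended by constants is
    continuous on the line but may have corners at 0 and 1. *)
Definition derivative_on (f f' : R -> R) : Prop :=
  (forall x, continuous f x) /\ (forall x, 0 < x < 1 -> is_derive f x (f' x)).

Definition derivative_chain (F0 F1 F2 F3 F4 : R -> R) : Prop :=
  derivative_on F0 F1 /\ derivative_on F1 F2 /\ derivative_on F2 F3 /\
  derivative_on F3 F4 /\ (forall x, continuous F4 x).

Lemma ex_RInt_cont (F : R -> R) a b : (forall x, continuous F x) -> ex_RInt F a b.
Proof. intros H. apply (ex_RInt_continuous (V := R_CompleteNormedModule)). intros; apply H. Qed.

Lemma peano_step F0 F1 F2 F3 F4 s L p0 p1 p2 p3 :
  derivative_chain F0 F1 F2 F3 F4 -> (forall x, 0 < x < 1 -> 0 <= F4 x) ->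
  0 <= s -> 0 <= L -> s + L <= 1 ->
  (forall x, 0 <= x <= L -> p0 + p1 * x + p2 * x ^ 2 / 2 + p3 * x ^ 3 / 6 + x ^ 4 / 24 <= 0) ->
  RInt F0 s (s + L) <=
    (p0 * F3 s - p1 * F2 s + p2 * F1 s - p3 * F0 s)
    - ((p0 + p1 * L + p2 * L ^ 2 / 2 + p3 * L ^ 3 / 6 + L ^ 4 / 24) * F3 (s + L)
       - (p1 + p2 * L + p3 * L ^ 2 / 2 + L ^ 3 / 6) * F2 (s + L)
       + (p2 + p3 * L + L ^ 2 / 2) * F1 (s + L) - (p3 + L) * F0 (s + L)).
Proof.
  intros ((C0 & D0) & (C1 & D1) & (C2 & D2) & (C3 & D3) & C4) Hpos Hs HL HsL Hp.
  set (P0 := fun x => p0 + p1 * x + p2 * x ^ 2 / 2 + p3 * x ^ 3 / 6 + x ^ 4 / 24) in *.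
  set (P1 := fun x => p1 + p2 * x + p3 * x ^ 2 / 2 + x ^ 3 / 6).
  set (P2 := fun x => p2 + p3 * x + x ^ 2 / 2). set (P3 := fun x => p3 + x).
  set (Phi := fun t => P0 (t - s) * F3 t - P1 (t - s) * F2 t + P2 (t - s) * F1 t
     - P3 (t - s) * F0 t + RInt F0 s t).
  assert (DI : forall t, is_derive (RInt F0 s) t (F0 t)).
  { intros t. apply (is_derive_RInt (V := R_NormedModule) F0 _ s); [|apply C0].
    exists (mkposreal 1 Rlt_0_1). intros y _. apply (RInt_correct (V := R_CompleteNormedModule)).
    apply ex_RInt_cont, C0. }
  assert (DP0 : forall t, is_derive (fun t => P0 (t - s)) t (P1 (t - s))) by
    (intros t; unfold P0, P1; auto_derive; [trivial|]; unfold Rdiv; field).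
  assert (DP1 : forall t, is_derive (fun t => P1 (t - s)) t (P2 (t - s))) by
    (intros t; unfold P1, P2; auto_derive; [trivial|]; unfold Rdiv; field).
  assert (DP2 : forall t, is_derive (fun t => P2 (t - s)) t (P3 (t - s))) by
    (intros t; unfold P2, P3; auto_derive; [trivial|]; unfold Rdiv; field).
  assert (DP3 : forall t, is_derive (fun t => P3 (t - s)) t 1) by
    (intros t; unfold P3; auto_derive; [trivial|]; unfold Rdiv; field).
  assert (prod : forall (f g : R -> R) t f' g', is_derive f t f' -> is_derive g t g' ->
    is_derive (fun t => f t * g t) t (f' * g t + f t * g')).
  { intros f g t f' g' Hf Hg. apply (is_derive_mult (K := R_AbsRing) f g t f' g' Hf Hg). intros; apply Rmult_comm. }
  assert (DPhi : forall t, 0 < t < 1 -> is_derive Phi t (P0 (t - s) * F4 t)).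
  { intros t Ht. unfold Phi.
    replace (P0 (t - s) * F4 t) with
     ((((P1 (t - s) * F3 t + P0 (t - s) * F4 t) - (P2 (t - s) * F2 t + P1 (t - s) * F3 t))
       + (P3 (t - s) * F1 t + P2 (t - s) * F2 t)) - (1 * F0 t + P3 (t - s) * F1 t) + F0 t) by ring.
    apply (is_derive_plus (K := R_AbsRing) (V := R_NormedModule)); [|apply DI].
    apply (is_derive_minus (K := R_AbsRing) (V := R_NormedModule));
      [|apply (prod (fun t => P3 (t - s)) F0); [apply DP3 | apply D0, Ht]].
    apply (is_derive_plus (K := R_AbsRing) (V := R_NormedModule));
      [|apply (prod (fun t => P2 (t - s)) F1); [apply DP2 | apply D1, Ht]].
    apply (is_derive_minus (K := R_AbsRing) (V := R_NormedModule));
      [apply (prod (fun t => P0 (t - s)) F3) | apply (prod (fun t => P1 (t - s)) F2)]; auto. }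
  assert (CP : forall (g : R -> R) (g' t : R), is_derive (fun t => g (t - s)) t g' -> continuous (fun t => g (t - s)) t).
  { intros g g' t Hg. apply (ex_derive_continuous (K := R_AbsRing) (V := R_NormedModule)). eexists; exact Hg. }
  assert (CPhi : forall t, continuous Phi t).
  { intros t. unfold Phi.
    apply (continuous_plus (V := R_NormedModule));
      [|apply (ex_derive_continuous (K := R_AbsRing) (V := R_NormedModule)); eexists; apply DI].
    apply (continuous_minus (V := R_NormedModule));
      [|apply (continuous_mult (K := R_AbsRing) (fun t => P3 (t - s)) F0); [eapply CP; apply DP3 | apply C0]].
    apply (continuous_plus (V := R_NormedModule));
      [|apply (continuous_mult (K := R_AbsRing) (fun t => P2 (t - s)) F1); [eapply CP; apply DP2 | apply C1]].
    apply (continuous_minus (V := R_NormedModule));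
      [apply (continuous_mult (K := R_AbsRing) (fun t => P0 (t - s)) F3); [eapply CP; apply DP0 | apply C3]
      | apply (continuous_mult (K := R_AbsRing) (fun t => P1 (t - s)) F2); [eapply CP; apply DP1 | apply C2]]. }
  assert (Mono : Phi (s + L) <= Phi s).
  (* [MVT_gen] places xi in the closed interval only, whereas the derivative and the sign of F4 are
     known inside (0,1). The default 0 gives the required inequality if xi is 0 or 1. *)
  { destruct (MVT_gen Phi s (s + L)
      (fun t => if Rlt_dec 0 t then if Rlt_dec t 1 then P0 (t - s) * F4 t else 0 else 0))
      as (xi & Hxi & E).
    - rewrite Rmin_left, Rmax_right by lra. intros x Hx.
      destruct (Rlt_dec 0 x); [|lra]. destruct (Rlt_dec x 1); [|lra]. apply DPhi; lra.
    - intros x _. apply continuity_pt_filterlim, CPhi.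
    - rewrite Rmin_left, Rmax_right in Hxi by lra.
      destruct (Rlt_dec 0 xi), (Rlt_dec xi 1); try lra.
      assert (P0 (xi - s) <= 0) by (apply Hp; lra).
      assert (0 <= F4 xi) by (apply Hpos; lra).
      assert (P0 (xi - s) * F4 xi <= 0) by nra.
      assert (P0 (xi - s) * F4 xi * (s + L - s) <= 0) by nra. lra. }
  assert (Z : RInt F0 s s = 0) by apply (RInt_point (V := R_CompleteNormedModule)).
  unfold Phi in Mono. rewrite Z in Mono.
  replace (s + L - s) with L in Mono by ring. rewrite Rminus_diag in Mono.
  unfold P0, P1, P2, P3 in *. lra.
Qed.

Lemma RInt_cont_Chasles (F : R -> R) a b c : (forall x, continuous F x) ->
  RInt F a c = RInt F a b + RInt F b c.
Proof. intros C. symmetry. apply (RInt_Chasles (V := R_CompleteNormedModule)); apply ex_RInt_cont, C. Qed.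

(** The quartic is h^4 (B_4(x/h) - 7/240) / 24 = (x^2 (h - x)^2 - h^4/16) / 24. At both knots it has
    value -h^4/384, slope 0 and second derivative h^2/12; its third derivative runs from -h/2 to
    h/2, which yields the trapezoidal weights. *)
Lemma middle_step F0 F1 F2 F3 F4 s h :
  derivative_chain F0 F1 F2 F3 F4 -> (forall x, 0 < x < 1 -> 0 <= F4 x) ->
  0 <= s -> 0 < h -> s + h <= 1 ->
  RInt F0 s (s + h) <= h ^ 4 / 384 * (F3 (s + h) - F3 s) - h ^ 2 / 12 * (F1 (s + h) - F1 s)
     + h / 2 * (F0 s + F0 (s + h)).
Proof.
  intros HF Hpos Hs Hh Hsh.
  assert (T := peano_step F0 F1 F2 F3 F4 s h (- h ^ 4 / 384) 0 (h ^ 2 / 12) (- h / 2) HF Hpos Hs ltac:(lra) Hsh).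
  eapply Rle_trans; [apply T; clear T | right; field].
  intros x Hx.
  assert (E : - h ^ 4 / 384 + 0 * x + h ^ 2 / 12 * x ^ 2 / 2 + - h / 2 * x ^ 3 / 6 + x ^ 4 / 24
    = - (h ^ 2 / 4 - x * (h - x)) * (h ^ 2 / 4 + x * (h - x)) / 24) by field.
  rewrite E.
  assert (0 <= x * (h - x)) by nra.
  assert (0 <= h ^ 2 / 4 - x * (h - x)) by (assert (0 <= (h / 2 - x) ^ 2) by apply pow2_ge_0; nra).
  nra.
Qed.

(* The last four arguments of [peano_step] in each instance are K, K', K'', K'''
   at the left end of the interval. *)
Lemma left_block F0 F1 F2 F3 F4 h :
  derivative_chain F0 F1 F2 F3 F4 -> (forall x, 0 < x < 1 -> 0 <= F4 x) ->
  0 < h -> 2 * h <= 1 ->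
  RInt F0 0 (2 * h) <= h * (43 / 192 * F0 0 + 29 / 72 * F0 (h / 2) + 83 / 96 * F0 h + 293 / 576 * F0 (2 * h))
     + h ^ 4 / 384 * F3 (2 * h) - h ^ 2 / 12 * F1 (2 * h).
Proof.
  intros HF Hpos Hh H2h.
  assert (C0 : forall x, continuous F0 x) by apply HF.
  assert (scale : forall x L, 0 <= x <= L * h -> exists y, 0 <= y <= L /\ x = h * y).
  { intros x L Hx. exists (x / h). split; [|field; lra].
    split; [apply Rdiv_le_0_compat; lra |]. apply (Rmult_le_reg_r h); [lra|].
    replace (x / h * h) with x by (field; lra). lra. }
  (* K and all its derivatives start from 0. Across an interval K''' grows by the length, and at
     each node it drops by the weight; K, K', K'' are continuous. At 2 h they reach -h^4/384, 0,
     h^2/12, the values in [middle_step]. *)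
  assert (T1 := peano_step F0 F1 F2 F3 F4 0 (h / 2) 0 0 0 (- 43 / 192 * h) HF Hpos ltac:(lra) ltac:(lra) ltac:(lra)).
  assert (T2 := peano_step F0 F1 F2 F3 F4 (h / 2) (h / 2)
     (- 19 / 9216 * h ^ 4) (- 11 / 1536 * h ^ 3) (5 / 384 * h ^ 2) (- 73 / 576 * h)
     HF Hpos ltac:(lra) ltac:(lra) ltac:(lra)).
  assert (T3 := peano_step F0 F1 F2 F3 F4 h h
     (- 7 / 1728 * h ^ 4) (5 / 1152 * h ^ 3) (43 / 576 * h ^ 2) (- 283 / 576 * h)
     HF Hpos ltac:(lra) ltac:(lra) ltac:(lra)).
  replace (0 + h / 2) with (h / 2) in T1 by ring.
  replace (h / 2 + h / 2) with h in T2 by field. replace (h + h) with (2 * h) in T3 by ring.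
  rewrite (RInt_cont_Chasles F0 0 h (2 * h) C0), (RInt_cont_Chasles F0 0 (h / 2) h C0).
  assert (H4 : 0 < h ^ 4) by (apply pow_lt; lra).
  eapply Rle_trans; [apply Rplus_le_compat; [apply Rplus_le_compat; [apply T1 | apply T2] | apply T3] |];
    clear T1 T2 T3.
  - intros x Hx. destruct (scale x (1 / 2)) as (y & Hy & ->); [lra|].
    replace (_ + _) with (h ^ 4 * (y ^ 3 * (y / 24 - 43 / 1152))) by field.
    assert (0 <= y ^ 3) by (apply pow_le; lra).
    assert (y ^ 3 * (y / 24 - 43 / 1152) <= 0) by nra. nra.
  - intros x Hx. destruct (scale x (1 / 2)) as (y & Hy & ->); [lra|].
    replace (_ + _) with (h ^ 4 * ((- 57 - 198 * y + 180 * y ^ 2 - 584 * y ^ 3 + 1152 * y ^ 4) / 27648)) by field.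
    assert (y ^ 2 <= y / 2) by nra.
    assert (0 <= y ^ 3) by (apply pow_le; lra).
    assert (y ^ 4 <= y ^ 3 / 2) by (simpl in *; nra).
    assert (- 57 - 198 * y + 180 * y ^ 2 - 584 * y ^ 3 + 1152 * y ^ 4 <= 0) by lra. nra.
  - intros x Hx. destruct (scale x 1) as (y & Hy & ->); [lra|].
    replace (_ + _) with (h ^ 4 * ((- 14 + 15 * y + 129 * y ^ 2 - 283 * y ^ 3 + 144 * y ^ 4) / 3456)) by field.
    (* Subtracting 144 times this product from the negated quartic leaves a small positive cubic
       term and a quadratic that is minimal near 568/1000 and positive there. *)
    assert (0 <= y * (1 - y) * (y - 48 / 100) ^ 2) by (apply Rmult_le_pos; [nra | apply pow2_ge_0]).
    assert (0 <= y ^ 3) by (apply pow_le; lra).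
    assert (0 <= (y - 568 / 1000) ^ 2) by apply pow2_ge_0.
    assert (- 14 + 15 * y + 129 * y ^ 2 - 283 * y ^ 3 + 144 * y ^ 4 <= 0) by nra. nra.
  - right. field.
Qed.

(** * Reflection and assembly of the blocks *)

Lemma derivative_on_reflect F F' : derivative_on F F' ->
  derivative_on (fun x => F (1 - x)) (fun x => - F' (1 - x)).
Proof.
  intros [C D]. split.
  - intros x. apply (continuous_comp (fun x => 1 - x) F); [|apply C].
    apply (ex_derive_continuous (K := R_AbsRing) (V := R_NormedModule)). auto_derive; trivial.
  - intros x Hx. replace (- F' (1 - x)) with (-1 * F' (1 - x)) by ring.
    apply (is_derive_comp (K := R_AbsRing) (V := R_NormedModule) F (fun x => 1 - x)); [apply D; lra|].
    auto_derive; [trivial | ring].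
Qed.

Lemma derivative_on_scal c F F' : derivative_on F F' -> derivative_on (fun x => c * F x) (fun x => c * F' x).
Proof.
  intros [C D]. split.
  - intros x. apply (continuous_mult (K := R_AbsRing) (fun _ => c) F); [apply continuous_const | apply C].
  - intros x Hx. apply is_derive_scal, D, Hx.
Qed.

Lemma derivative_on_plus F F' G G' : derivative_on F F' -> derivative_on G G' ->
  derivative_on (fun x => F x + G x) (fun x => F' x + G' x).
Proof.
  intros [C D] [C' D']. split.
  - intros x. apply (continuous_plus (V := R_NormedModule) F G); auto.
  - intros x Hx. apply (is_derive_plus (K := R_AbsRing) (V := R_NormedModule) F G); auto.
Qed.

Lemma derivative_on_ext F F' G' : (forall x, F' x = G' x) -> derivative_on F F' -> derivative_on F G'.
Proof. intros E [C D]. split; [exact C|]. intros x Hx. rewrite <- E. apply D, Hx. Qed.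

Lemma derivative_chain_reflect F0 F1 F2 F3 F4 : derivative_chain F0 F1 F2 F3 F4 ->
  derivative_chain (fun x => F0 (1 - x)) (fun x => - F1 (1 - x)) (fun x => F2 (1 - x))
    (fun x => - F3 (1 - x)) (fun x => F4 (1 - x)).
Proof.
  intros (H0 & H1 & H2 & H3 & C4).
  assert (N : forall F F', derivative_on F F' -> derivative_on (fun x => - F (1 - x)) (fun x => F' (1 - x))).
  { intros F F' H. assert (K := derivative_on_scal (-1) _ _ (derivative_on_reflect _ _ H)). destruct K as [C D].
    split.
    - intros x. apply (continuous_ext (fun x => -1 * F (1 - x))); [intros y; simpl; ring | apply C].
    - intros x Hx. apply (is_derive_ext (fun x => -1 * F (1 - x))); [intros y; simpl; ring |].
      replace (F' (1 - x)) with (-1 * - F' (1 - x)) by ring. apply D, Hx. }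
  refine (conj (derivative_on_reflect _ _ H0) (conj (N _ _ H1)
    (conj (derivative_on_reflect _ _ H2) (conj (N _ _ H3) _)))).
  intros x. apply (continuous_comp (fun x => 1 - x) F4); [|apply C4].
  apply (ex_derive_continuous (K := R_AbsRing) (V := R_NormedModule)). auto_derive; trivial.
Qed.

Lemma RInt_reflect01 (F : R -> R) a : (forall x, continuous F x) ->
  RInt (fun x => F (1 - x)) 0 a = RInt F (1 - a) 1.
Proof.
  intros C.
  assert (E := RInt_comp_lin (V := R_CompleteNormedModule) F (-1) 1 0 a (ex_RInt_cont F _ _ C)).
  replace (-1 * 0 + 1) with 1 in E by ring. replace (-1 * a + 1) with (1 - a) in E by ring.
  assert (Eq0 : forall y : R, 1 - y = -1 * y + 1) by (intros; ring).
  assert (E0 : RInt (fun x => F (1 - x)) 0 a = RInt (fun y => F (-1 * y + 1)) 0 a).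
  { apply (RInt_ext (V := R_CompleteNormedModule)). intros x _. f_equal. apply Eq0. }
  assert (C' : forall x, continuous (fun y => F (-1 * y + 1)) x).
  { intros x. apply (continuous_comp (fun y => -1 * y + 1) F); [|apply C].
    apply (ex_derive_continuous (K := R_AbsRing) (V := R_NormedModule)). auto_derive; trivial. }
  assert (E1 : RInt (fun y => -1 * F (-1 * y + 1)) 0 a = -1 * RInt (fun y => F (-1 * y + 1)) 0 a)
    by exact (RInt_scal (V := R_CompleteNormedModule) _ 0 a (-1) (ex_RInt_cont _ 0 a C')).
  assert (E2 : - RInt F 1 (1 - a) = RInt F (1 - a) 1)
    by exact (opp_RInt_swap (V := R_CompleteNormedModule) F 1 (1 - a) (ex_RInt_cont F _ _ C)).
  change (RInt (fun y => -1 * F (-1 * y + 1)) 0 a = RInt F 1 (1 - a)) in E.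
  rewrite E0, <- E2, <- E, E1. lra.
Qed.

(** Summation of [middle_step]: the terms in F1 and F3 telescope. The last summand turns the
    one-sided sum into a trapezoidal one. *)
Lemma middle_block F0 F1 F2 F3 F4 n m :
  derivative_chain F0 F1 F2 F3 F4 -> (forall x, 0 < x < 1 -> 0 <= F4 x) ->
  (0 < n)%nat -> (2 + m <= n)%nat ->
  let h := / INR n in let x := fun k => INR k / INR n in
  RInt F0 (x 2%nat) (x (2 + m)%nat) <=
    h ^ 4 / 384 * (F3 (x (2 + m)%nat) - F3 (x 2%nat)) - h ^ 2 / 12 * (F1 (x (2 + m)%nat) - F1 (x 2%nat))
     + h * (sum_n_m (fun k => F0 (x k)) 3 (2 + m) + (F0 (x 2%nat) - F0 (x (2 + m)%nat)) / 2).
Proof.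
  intros HF Hpos Hn Hm h x.
  assert (C0 : forall x, continuous F0 x) by apply HF.
  assert (Hn' : 0 < INR n) by (apply lt_0_INR; lia).
  assert (Hh : 0 < h) by (apply Rinv_0_lt_compat; exact Hn').
  induction m as [|m IH].
  - rewrite sum_n_m_zero by lia. change (2 + 0)%nat with 2%nat.
    replace (RInt F0 (x 2%nat) (x 2%nat)) with 0 by (symmetry; apply (RInt_point (V := R_CompleteNormedModule))).
    change (@zero R_AbelianMonoid) with 0. lra.
  - specialize (IH ltac:(lia)).
    assert (Ex : x (2 + S m)%nat = x (2 + m)%nat + h).
    { unfold x, h. replace (2 + S m)%nat with (S (2 + m)) by lia. rewrite S_INR. field. lra. }
    assert (Hx1 : x (2 + S m)%nat <= 1).
    { unfold x. apply (Rmult_le_reg_r (INR n)); [lra|]. unfold Rdiv. rewrite Rmult_assoc, Rinv_l by lra.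
      assert (INR (2 + S m) <= INR n) by (apply le_INR; lia). lra. }
    assert (Hx0 : 0 <= x (2 + m)%nat) by (apply Rdiv_le_0_compat; [apply pos_INR | lra]).
    assert (T := middle_step _ _ _ _ _ (x (2 + m)%nat) h HF Hpos Hx0 Hh ltac:(lra)).
    rewrite (RInt_cont_Chasles F0 _ (x (2 + m)%nat) _ C0).
    replace (2 + S m)%nat with (S (2 + m)) in * by lia.
    rewrite sum_n_Sm by lia. change plus with Rplus.
    rewrite <- Ex in T. lra.
Qed.

(** The terms in F1 and F3 at 2/n and 1 - 2/n cancel between the three blocks, and the weights there
    add up as 293/576 + 1/2 = 581/576. *)
Lemma Qf_overestimates F0 F1 F2 F3 F4 n : (5 <= n)%nat ->
  derivative_chain F0 F1 F2 F3 F4 -> (forall x, 0 < x < 1 -> 0 <= F4 x) ->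
  RInt F0 0 1 <= Qf n F0.
Proof.
  intros Hn HF Hpos.
  assert (C0 : forall x, continuous F0 x) by apply HF.
  assert (Hn5 : 5 <= INR n) by (replace 5 with (INR 5) by (simpl; ring); apply le_INR, Hn).
  set (h := / INR n).
  assert (Hh : 0 < h) by (apply Rinv_0_lt_compat; lra).
  assert (Hh5 : h <= / 5) by (apply Rinv_le_contravar; lra).
  assert (L := left_block _ _ _ _ _ h HF Hpos Hh ltac:(lra)).
  assert (Rr := left_block _ _ _ _ _ h (derivative_chain_reflect _ _ _ _ _ HF)
     (fun x Hx => Hpos (1 - x) ltac:(lra)) Hh ltac:(lra)).
  cbv beta in Rr. rewrite (RInt_reflect01 F0 _ C0) in Rr.
  (* With m = n - 4 the block ends at (n - 2)/n; the last term of its sum is split off because that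
     node carries an end weight. *)
  assert (M := middle_block _ _ _ _ _ n (n - 4) HF Hpos ltac:(lia) ltac:(lia)). cbv beta zeta in M.
  fold h in M.
  replace (2 + (n - 4))%nat with (S (n - 3)) in M by lia.
  rewrite sum_n_Sm in M by lia. change plus with Rplus in M.
  replace (S (n - 3)) with (n - 2)%nat in M by lia.
  replace (INR (n - 2) / INR n) with (1 - 2 * h) in M
    by (rewrite minus_INR by lia; unfold h; simpl (INR 2); field; lra).
  replace (INR 2 / INR n) with (2 * h) in M by (unfold h; simpl (INR 2); field; lra).
  rewrite (RInt_cont_Chasles F0 0 (2 * h) 1 C0), (RInt_cont_Chasles F0 (2 * h) (1 - 2 * h) 1 C0).
  unfold Qf, Defs.sigma.
  replace (1 - 0) with 1 in * by ring.
  replace (1 / (2 * INR n)) with (h / 2) by (unfold h; field; lra).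
  replace (1 / INR n) with h by (unfold h; field; lra).
  replace (2 / INR n) with (2 * h) by (unfold h; field; lra).
  replace (43 / (192 * INR n)) with (43 / 192 * h) by (unfold h; field; lra).
  replace (29 / (72 * INR n)) with (29 / 72 * h) by (unfold h; field; lra).
  replace (83 / (96 * INR n)) with (83 / 96 * h) by (unfold h; field; lra).
  replace (581 / (576 * INR n)) with (581 / 576 * h) by (unfold h; field; lra).
  lra.
Qed.

(** * Definiteness of the given formula *)

(* Composition with [clip] turns the one-sided notions of [Cr01] at 0 and 1 into
   continuity on the whole line. *)
Definition clip (x : R) : R := Rmax 0 (Rmin 1 x).

Lemma clip_I01 x : I01 (clip x).
Proof. unfold I01, clip, Rmax, Rmin. repeat destruct Rle_dec; lra. Qed.

Lemma clip_id x : I01 x -> clip x = x.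
Proof. intros [H0 H1]. unfold clip, Rmax, Rmin. repeat destruct Rle_dec; lra. Qed.

Lemma clip_lip x y : Rabs (clip x - clip y) <= Rabs (x - y).
Proof. unfold clip, Rmax, Rmin, Rabs. repeat destruct Rle_dec; repeat destruct Rcase_abs; lra. Qed.

Lemma continuous_clip (g : R -> R) :
  (forall x, I01 x -> continue_in g I01 x) -> forall x, continuous (fun x => g (clip x)) x.
Proof.
  intros H x. apply continuity_pt_filterlim. intros e He.
  destruct (H (clip x) (clip_I01 x) e He) as (d & Hd & K).
  exists d; split; [exact Hd|]. intros y [_ Hy]. simpl in *. unfold Rdist in *.
  (* [continue_in] tests only points different from the limit point, so the case in which x and y
     clip to the same point is separate. *)
  destruct (Req_dec (clip x) (clip y)) as [E|E].
  - rewrite E, Rminus_diag, Rabs_R0. exact He.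
  - apply K. split; [split; [apply clip_I01 | exact E]|].
    eapply Rle_lt_trans; [apply clip_lip | exact Hy].
Qed.

Lemma derivative_on_clip (g g' : R -> R) : (forall x, I01 x -> D_in g g' I01 x) ->
  derivative_on (fun x => g (clip x)) (fun x => g' (clip x)).
Proof.
  intros H. split.
  - apply continuous_clip. intros x Hx. apply (cont_deriv g g' I01 x), H, Hx.
  - intros x Hx. apply is_derive_Reals. intros e He.
    assert (Ix : I01 x) by (split; lra).
    destruct (H x Ix e He) as (d & Hd & K).
    assert (Hm : 0 < Rmin d (Rmin x (1 - x))) by (repeat apply Rmin_pos; lra).
    exists (mkposreal _ Hm). intros k Hk Hkd. simpl in Hkd.
    assert (K1 : Rabs k < d) by (eapply Rlt_le_trans; [exact Hkd | apply Rmin_l]).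
    assert (K2 : Rabs k < x) by (eapply Rlt_le_trans; [exact Hkd | eapply Rle_trans; [apply Rmin_r | apply Rmin_l]]).
    assert (K3 : Rabs k < 1 - x) by (eapply Rlt_le_trans; [exact Hkd | eapply Rle_trans; [apply Rmin_r | apply Rmin_r]]).
    apply Rabs_def2 in K2. apply Rabs_def2 in K3.
    assert (Ik : I01 (x + k)) by (split; lra).
    rewrite (clip_id x Ix), (clip_id _ Ik).
    assert (T := K (x + k)). simpl in T. unfold Rdist in T.
    replace (x + k - x) with k in T by ring. apply T.
    split; [|exact K1]. split; [exact Ik | lra].
Qed.

Lemma derivative_chain_of_Cr01 f fr : Cr01 4 f fr -> exists F1 F2 F3,
  derivative_chain (fun x => f (clip x)) F1 F2 F3 (fun x => fr (clip x)).
Proof.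
  intros [(f1 & D1 & f2 & D2 & f3 & D3 & f4 & D4 & E) C].
  exists (fun x => f1 (clip x)), (fun x => f2 (clip x)), (fun x => f3 (clip x)).
  refine (conj (derivative_on_clip _ _ D1) (conj (derivative_on_clip _ _ D2)
    (conj (derivative_on_clip _ _ D3) (conj _ (continuous_clip _ C))))).
  apply (derivative_on_ext _ (fun x => f4 (clip x))); [|apply derivative_on_clip, D4].
  intros x. symmetry. apply E, clip_I01.
Qed.

(** Adding b x^4 shifts the fourth derivative by a constant, which turns upper and lower bounds on
    it into sign conditions. *)
Lemma derivative_chain_combine a b F0 F1 F2 F3 F4 : derivative_chain F0 F1 F2 F3 F4 ->
  derivative_chain (fun x => a * F0 x + b * (x ^ 4)) (fun x => a * F1 x + b * (4 * x ^ 3))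
    (fun x => a * F2 x + b * (12 * x ^ 2)) (fun x => a * F3 x + b * (24 * x)) (fun x => a * F4 x + b * 24).
Proof.
  intros (H0 & H1 & H2 & H3 & C4).
  assert (P : forall p p' : R -> R, (forall x, is_derive p x (p' x)) -> derivative_on p p').
  { intros p p' H. split; [|intros; apply H].
    intros x. apply (ex_derive_continuous (K := R_AbsRing) (V := R_NormedModule)). eexists; apply H. }
  refine (conj (derivative_on_plus _ _ _ _ (derivative_on_scal _ _ _ H0) (derivative_on_scal _ _ _ (P _ _ _)))
    (conj (derivative_on_plus _ _ _ _ (derivative_on_scal _ _ _ H1) (derivative_on_scal _ _ _ (P _ _ _)))
    (conj (derivative_on_plus _ _ _ _ (derivative_on_scal _ _ _ H2) (derivative_on_scal _ _ _ (P _ _ _)))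
    (conj (derivative_on_plus _ _ _ _ (derivative_on_scal _ _ _ H3) (derivative_on_scal _ _ _ (P _ (fun _ => 24) _))) _))));
    try (intros x; auto_derive; [trivial | ring]).
  intros x. apply (continuous_plus (V := R_NormedModule) (fun x => a * F4 x) (fun _ => b * 24)); [|apply continuous_const].
  apply (continuous_mult (K := R_AbsRing) (fun _ => a) F4); [apply continuous_const | apply C4].
Qed.

Definition Qf_node (n i : nat) : R :=
  if Nat.leb i 1 then 0 else if Nat.eqb i 2 then 1 / (2 * INR n) else if Nat.eqb i 3 then 1 / INR n
  else if Nat.leb i n then INR (i - 2) / INR n else if Nat.eqb i (n + 1) then 1 - 1 / INR n
  else if Nat.eqb i (n + 2) then 1 - 1 / (2 * INR n) else 1.

Definition Qf_weight (n i : nat) : R :=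
  if orb (Nat.eqb i 1) (Nat.eqb i (n + 3)) then 43 / (192 * INR n)
  else if orb (Nat.eqb i 2) (Nat.eqb i (n + 2)) then 29 / (72 * INR n)
  else if orb (Nat.eqb i 3) (Nat.eqb i (n + 1)) then 83 / (96 * INR n)
  else if orb (Nat.eqb i 4) (Nat.eqb i n) then 581 / (576 * INR n) else 1 / INR n.

Ltac nat_cases := repeat match goal with
  | |- context [Nat.leb ?a ?b] => destruct (Nat.leb_spec a b); try lia
  | |- context [Nat.eqb ?a ?b] => destruct (Nat.eqb_spec a b); try lia
  end; cbn [orb].

Lemma Qf_is_quadrature n : (5 <= n)%nat -> is_quadrature (n + 3) (Qf n).
Proof.
  intros Hn.
  assert (Hn5 : 5 <= INR n) by (replace 5 with (INR 5) by (simpl; ring); apply le_INR, Hn).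
  set (h := / INR n).
  assert (Hh : 0 < h) by (apply Rinv_0_lt_compat; lra).
  assert (Hnh : INR n * h = 1) by (unfold h; field; lra).
  assert (E1 : 1 / INR n = h) by (unfold h; field; lra).
  assert (E2 : 1 / (2 * INR n) = h / 2) by (unfold h; field; lra).
  assert (Hstep : forall i, (1 <= i)%nat -> (i < n + 3)%nat -> Qf_node n i < Qf_node n (S i)).
  { intros i H1 H2. unfold Qf_node. rewrite E1, E2. unfold Rdiv. fold h.
    nat_cases; subst; try lra;
     try (replace (S i - 2)%nat with (S (i - 2)) by lia; rewrite S_INR, minus_INR by lia; simpl (INR 2);
       assert (4 <= INR i) by (replace 4 with (INR 4) by (simpl; ring); apply le_INR; lia); nra).
    - simpl. lra.
    - replace i with n by lia. rewrite minus_INR by lia. simpl (INR 2). nra. }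
  assert (Hlt : forall i j, (1 <= i)%nat -> (i < j)%nat -> (j <= n + 3)%nat -> Qf_node n i < Qf_node n j).
  { intros i j H1 H2 H3. induction H2 as [|j H2 IH]; [apply Hstep; lia|].
    eapply Rlt_trans; [apply IH; lia | apply Hstep; lia]. }
  assert (N1 : Qf_node n 1 = 0) by reflexivity.
  assert (NN : Qf_node n (n + 3) = 1) by (unfold Qf_node; nat_cases; reflexivity).
  exists (Qf_weight n), (Qf_node n). split; [|split].
  - intros i Hi. split.
    + destruct (Nat.eq_dec i 1) as [->|]; [lra|]. left. rewrite <- N1. apply Hlt; lia.
    + destruct (Nat.eq_dec i (n + 3)) as [->|]; [lra|]. left. rewrite <- NN. apply Hlt; lia.
  - exact Hlt.
  - intros f. set (g := fun i => Qf_weight n i * f (Qf_node n i)).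
    assert (G : sum_n_m g 1 (n + 3) =
       g 1%nat + g 2%nat + g 3%nat + g 4%nat + sum_n_m (fun k => 1 / INR n * f (INR k / INR n)) 3 (n - 3)
       + g n + g (n + 1)%nat + g (n + 2)%nat + g (n + 3)%nat).
    (* Four terms are peeled off at each end. Since the index starts at 1 and 1/(2n) is an extra
       node, k/n has index k + 2; so the indices 5 to n - 1 correspond to k from 3 to n - 3, an
       empty range for n = 5. *)
    { replace (n + 3)%nat with (S (S (S (S (n - 1))))) by lia.
      rewrite !sum_n_Sm by lia. rewrite !(sum_Sn_m g _ (n - 1)) by lia.
      replace (S (S (S (S (n - 1))))) with (n + 3)%nat by lia.
      replace (S (S (S (n - 1)))) with (n + 2)%nat by lia.
      replace (S (S (n - 1))) with (n + 1)%nat by lia.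
      replace (S (n - 1)) with n by lia.
      replace (sum_n_m g 5 (n - 1)) with (sum_n_m (fun k => 1 / INR n * f (INR k / INR n)) 3 (n - 3)).
      - change plus with Rplus. lra.
      - replace (n - 1)%nat with (S (S (n - 3))) by lia. rewrite <- !sum_n_m_S.
        apply sum_n_m_ext_loc. intros k Hk. unfold g, Qf_weight, Qf_node.
        nat_cases. replace (S (S k) - 2)%nat with k by lia. reflexivity. }
    rewrite G. unfold g, Qf_weight, Qf_node. nat_cases.
    unfold Qf, Defs.sigma.
    assert (Es : 1 / INR n * sum_n_m (fun k => f (INR k / INR n)) 3 (n - 3)
        = sum_n_m (fun k => 1 / INR n * f (INR k / INR n)) 3 (n - 3))
      by (symmetry; exact (sum_n_m_mult_l (K := R_Ring) (1 / INR n) (fun k => f (INR k / INR n)) 3 (n - 3))).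
    rewrite Es.
    replace (1 - 0) with 1 by ring.
    replace (INR (4 - 2) / INR n) with (2 / INR n) by (simpl; reflexivity).
    replace (INR (n - 2) / INR n) with (1 - 2 / INR n) by (rewrite minus_INR by lia; simpl (INR 2); field; lra).
    ring.
Qed.

(** * The value of the error constant and the mean value form *)

Definition Qf_error (n : nat) : R := - (7 / (5760 * INR n ^ 4)) * (1 + 55 / (28 * INR n)).

Lemma sum_pow4 m : sum_n_m (fun k => INR k ^ 4) 0 m
  = INR m * (INR m + 1) * (2 * INR m + 1) * (3 * INR m ^ 2 + 3 * INR m - 1) / 30.
Proof.
  induction m as [|m IH].
  - rewrite sum_n_n. simpl. lra.
  - rewrite sum_n_Sm by lia. rewrite IH, S_INR. change plus with Rplus. lra.
Qed.

Lemma Qf_pow4 n : (5 <= n)%nat -> 1 / 120 - Qf n (fun x => x ^ 4) / 24 = Qf_error n.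
Proof.
  intros Hn.
  assert (Hn5 : 5 <= INR n) by (replace 5 with (INR 5) by (simpl; ring); apply le_INR, Hn).
  (* The number 17 = 1^4 + 2^4 removes k = 1 and k = 2 from the full sum of fourth powers. *)
  assert (S : sum_n_m (fun k => (INR k / INR n) ^ 4) 3 (n - 3) = / INR n ^ 4 *
    ((INR n - 3) * (INR n - 2) * (2 * INR n - 5) * (3 * (INR n - 3) ^ 2 + 3 * (INR n - 3) - 1) / 30 - 17)).
  { assert (E : forall k, (INR k / INR n) ^ 4 = / INR n ^ 4 * INR k ^ 4) by (intros k; field; lra).
    rewrite (sum_n_m_ext _ _ _ _ E).
    rewrite (sum_n_m_mult_l (K := R_Ring)). change mult with Rmult. f_equal.
    assert (T := sum_pow4 (n - 3)). rewrite !sum_Sn_m in T by lia. change plus with Rplus in T.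
    rewrite minus_INR in T by lia. simpl (INR 0) in T. simpl (INR 1) in T. simpl (INR 2) in T. simpl (INR 3) in T.
    set (Z := sum_n_m (G := R_AbelianMonoid) (fun k => INR k ^ 4) 3 (n - 3)) in T.
    match goal with |- _ = ?b => change (Z = b) end. lra. }
  unfold Qf, Defs.sigma. rewrite S. unfold Qf_error. field. lra.
Qed.

Lemma Qf_error_neg n : (5 <= n)%nat -> Qf_error n < 0.
Proof.
  intros Hn.
  assert (Hn5 : 5 <= INR n) by (replace 5 with (INR 5) by (simpl; ring); apply le_INR, Hn).
  assert (0 < 7 / (5760 * INR n ^ 4)).
  { apply Rdiv_lt_0_compat; [lra|]. apply Rmult_lt_0_compat; [lra | apply pow_lt; lra]. }
  assert (0 < 55 / (28 * INR n)) by (apply Rdiv_lt_0_compat; lra).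
  unfold Qf_error. nra.
Qed.

Lemma Qf_negative_definite n : (5 <= n)%nat -> negative_definite 4 (Qf n) (Qf_error n).
Proof.
  intros Hn. assert (Hneg := Qf_error_neg n Hn). split; [exact Hneg|]. intros f fr Hf.
  destruct (derivative_chain_of_Cr01 _ _ Hf) as (F1 & F2 & F3 & HF).
  set (F0 := fun x => f (clip x)) in *. set (F4 := fun x => fr (clip x)) in *.
  assert (HQ := Qf_is_quadrature n Hn).
  assert (CF4 : forall x, continuous F4 x) by apply HF.
  assert (CF0 : forall x, continuous F0 x) by apply HF.
  assert (Cpt : forall x, continuity_pt F4 x) by (intros x; apply continuity_pt_filterlim, CF4).
  assert (ER : remainder (Qf n) f = RInt F0 0 1 - Qf n F0).
  { assert (E1 : RInt f 0 1 = RInt F0 0 1).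
    { apply (RInt_ext (V := R_CompleteNormedModule)). intros x Hx.
      rewrite Rmin_left, Rmax_right in Hx by lra.
      unfold F0. rewrite clip_id; [reflexivity | split; lra]. }
    assert (E2 : Qf n f = Qf n F0).
    { apply (quad_ext _ _ HQ). intros x Hx. unfold F0. rewrite clip_id; [reflexivity | exact Hx]. }
    unfold remainder. rewrite E1, E2. reflexivity. }
  (* Taking a = 1 with the minimum of F4 and a = -1 with its maximum encloses the quotient of
     remainder and error constant between these extremes; the intermediate value theorem then
     supplies xi. *)
  assert (Comb : forall a b, (forall x, 0 < x < 1 -> 0 <= a * F4 x + b * 24) ->
    a * (RInt F0 0 1 - Qf n F0) + b * (24 * Qf_error n) <= 0).
  { intros a b Hab.
    assert (T := Qf_overestimates _ _ _ _ _ n Hn (derivative_chain_combine a b _ _ _ _ _ HF) Hab).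
    rewrite (quad_plus _ _ HQ), !(quad_scal _ _ HQ) in T.
    assert (Cx : forall x, continuous (fun x : R => x ^ 4) x).
    { intros x. apply (ex_derive_continuous (K := R_AbsRing) (V := R_NormedModule)). auto_derive; trivial. }
    assert (EI : RInt (fun x => a * F0 x + b * x ^ 4) 0 1 = a * RInt F0 0 1 + b * RInt (fun x => x ^ 4) 0 1).
    { apply is_RInt_unique. apply (is_RInt_plus (V := R_NormedModule));
      apply (is_RInt_scal (V := R_NormedModule)), (RInt_correct (V := R_CompleteNormedModule));
      apply ex_RInt_cont; assumption. }
    rewrite EI, RInt_pow01 in T. simpl (INR 5) in T. rewrite <- (Qf_pow4 n Hn). lra. }
  destruct (continuity_ab_min F4 0 1 ltac:(lra) (fun x _ => Cpt x)) as (xm & Hm & Ixm).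
  destruct (continuity_ab_maj F4 0 1 ltac:(lra) (fun x _ => Cpt x)) as (xM & HM & IxM).
  assert (L := Comb 1 (- F4 xm / 24) ltac:(intros x Hx; assert (K := Hm x ltac:(lra)); lra)).
  assert (U := Comb (-1) (F4 xM / 24) ltac:(intros x Hx; assert (K := HM x ltac:(lra)); lra)).
  rewrite ER. set (R := RInt F0 0 1 - Qf n F0) in *.
  assert (Hmid : F4 xm <= R / Qf_error n <= F4 xM).
  { split.
    - apply Rnot_lt_le. intros K.
      assert (R / Qf_error n * Qf_error n = R) by (field; lra). nra.
    - apply Rnot_lt_le. intros K.
      assert (R / Qf_error n * Qf_error n = R) by (field; lra). nra. }
  assert (Hle : F4 xm <= F4 xM) by lra.
  destruct (IVT_gen F4 xm xM (R / Qf_error n) Cpt) as (xi & Hxi & E).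
  { rewrite Rmin_left, Rmax_right by lra. exact Hmid. }
  assert (Ixi : I01 xi).
  { destruct Hxi as [H1 H2]. split.
    - eapply Rle_trans; [|exact H1]. apply Rmin_glb; lra.
    - eapply Rle_trans; [exact H2|]. apply Rmax_lub; lra. }
  exists xi; split; [exact Ixi|].
  unfold F4 in E. rewrite clip_id in E by exact Ixi. rewrite E. field. lra.
Qed.

(** * Asymptotic optimality *)

Lemma c_minus_bounds n : (5 <= n)%nat ->
  Qf_error n <= c_minus (n + 3) 4 <= - (7 / 5760) / (INR n + 4) ^ 4.
Proof.
  intros Hn. unfold c_minus.
  set (S := fun c => exists Q : functional, is_quadrature (n + 3) Q /\ negative_definite 4 Q c).
  destruct (Lub_Rbar_correct S) as [Hub Hlub].
  assert (HS : S (Qf_error n)).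
  { exists (Qf n). split; [apply Qf_is_quadrature, Hn | apply Qf_negative_definite, Hn]. }
  assert (HB : Rbar_le (Lub_Rbar S) (- (7 / 5760) / (INR n + 4) ^ 4)).
  { apply Hlub. intros c (Q & HQ & Hneg). simpl.
    assert (T := error_constant_upper_bound _ _ _ HQ Hneg).
    rewrite plus_INR in T. simpl (INR 3) in T. replace (INR n + (1 + 1 + 1) + 1) with (INR n + 4) in T by ring. exact T. }
  assert (HA := Hub _ HS).
  (* [HA] and [HB] exclude an infinite supremum, so [real] does not fall back to its default 0. *)
  destruct (Lub_Rbar S) as [l| |]; simpl in *; try contradiction. lra.
Qed.

Theorem mainTheorem5 :
  (forall n : nat, (5 <= n)%nat ->
     is_quadrature (n + 3) (Qf n) /\
     negative_definite 4 (Qf n)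
       (- (7 / (5760 * INR n ^ 4)) * (1 + 55 / (28 * INR n)))) /\
  asymptotically_optimal_negative_definite 4 (fun n => (n + 3)%nat) Qf.
Proof.
  assert (H : forall n : nat, (5 <= n)%nat ->
     is_quadrature (n + 3) (Qf n) /\ negative_definite 4 (Qf n) (Qf_error n)).
  { intros n Hn. split; [apply Qf_is_quadrature, Hn | apply Qf_negative_definite, Hn]. }
  split; [exact H|].
  exists Qf_error. split; [exists 5%nat; exact H|].
  (* The upper comparison sequence is [Qf_error n] divided by the universal bound -7/5760 / (n +
     4)^4. All constants are negative, so a bound from above on [c_minus] bounds the ratio from
     above. *)
  apply (is_lim_seq_le_le_loc (fun _ => 1) _ (fun n => (1 + 55 / 28 * / INR n) * (1 + 4 * / INR n) ^ 4)).
  - exists 5%nat. intros n Hn.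
    assert (Hn5 : 5 <= INR n) by (replace 5 with (INR 5) by (simpl; ring); apply le_INR, Hn).
    destruct (c_minus_bounds n Hn) as [Lo Up].
    set (cm := c_minus (n + 3) 4) in *.
    assert (Hpow : 0 < (INR n + 4) ^ 4) by (apply pow_lt; lra).
    assert (Hup : - (7 / 5760) / (INR n + 4) ^ 4 < 0).
    { unfold Rdiv. rewrite Ropp_mult_distr_l_reverse. apply Ropp_lt_gt_0_contravar.
      apply Rmult_lt_0_compat; [lra | apply Rinv_0_lt_compat, Hpow]. }
    assert (Hcm : cm < 0) by lra.
    assert (Hq : Qf_error n / cm * cm = Qf_error n) by (field; lra).
    split.
    + apply Rnot_lt_le. intros K. nra.
    + set (X := (1 + 55 / 28 * / INR n) * (1 + 4 * / INR n) ^ 4).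
      assert (HX : X * (- (7 / 5760) / (INR n + 4) ^ 4) = Qf_error n).
      { unfold X, Qf_error. field. split; lra. }
      assert (0 < X).
      { assert (0 < / INR n) by (apply Rinv_0_lt_compat; lra).
        apply Rmult_lt_0_compat; [lra | apply pow_lt; lra]. }
      apply Rnot_lt_le. intros K. nra.
  - apply is_lim_seq_const.
  - assert (I : is_lim_seq (fun n => / INR n) 0).
    { replace (Finite 0) with (Rbar_inv p_infty) by reflexivity.
      apply is_lim_seq_inv; [apply is_lim_seq_INR | discriminate]. }
    assert (A : forall c, is_lim_seq (fun n => 1 + c * / INR n) 1).
    { intros c. replace (Finite 1) with (Finite (1 + c * 0)) by (f_equal; ring).
      apply is_lim_seq_plus'; [apply is_lim_seq_const|].
      apply (is_lim_seq_scal_l _ c 0 I). }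
    replace (Finite 1) with (Finite (1 * (1 * (1 * (1 * (1 * 1)))))) by (f_equal; ring).
    repeat (apply is_lim_seq_mult'; [apply A|]). apply is_lim_seq_const.
Qed.
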